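(* The following two identities hold: $$\mathscr{C}_1(t;q) = (-q^3;q^3)_\infty\,\theta(-t^2q^2;q^6) + \mathscr{C}_2(t;q)\,\bigl(1-\Theta_1(t;q)\bigr) + \mathscr{C}^{\ast}_2(t;q)\,\bigl(1-\Theta_2(t;q)\bigr),$$ $$\mathscr{C}_3(t;q) = -(-q^3;q^3)_\infty\,\theta(-t^2q^2;q^6) + \mathscr{C}_2(t;q)\,\Theta_1(t;q) + \mathscr{C}^{\ast}_2(t;q)\,\Theta_2(t;q),$$ where $$\Theta_1(t;q) := \sum_{k\ge 0}\chi_3(k)\,t^{-k}q^{k(k+1)},\qquad \Theta_2(t;q) := \sum_{k\ge 0}\chi_3(k)\,t^{k}q^{k^2},$$ and $\chi_3(m) := \left(\frac{m+1}{3}\right)$ is the shifted Dirichlet character (Legendre symbol modulo $3$ evaluated at $m+1$).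
   Context: All identities are between power series in $q$ whose coefficients are Laurent polynomials in $t$. A partition satisfies the level $3$ gap condition if successive parts differ by at least $2$, and two parts differ by $2$ or $3$ only if their sum is a multiple of $3$ (the empty partition is included). For a partition $\lambda$, $|\lambda|$ denotes its size (the sum of its parts), and for $j\in\{1,2\}$, $\nu_j(\lambda)$ is the number of parts of $\lambda$ congruent to $j$ modulo $3$. For $m\ge 1$, $$\mathscr{C}_m(t;q) := \sum_{\lambda} t^{\nu_1(\lambda)-\nu_2(\lambda)}q^{|\lambda|},$$ where the sum is over all partitions $\lambda$ satisfying the level $3$ gap condition and all of whose parts are at least $m$. Moreover, $$\mathscr{C}^{\ast}_2(t;q) := \mathscr{C}_1(t;q)-\mathscr{C}_2(t;q)+\mathscr{C}_3(t;q),$$ which is the corresponding generating function for partitions satisfying the level $3$ gap condition and not containing $2$ as a part. Notation: $(a;q)_n := \prod_{j=0}^{n-1}(1-aq^j)$ for $n\in\mathbb{N}_0\cup\{\infty\}$, and $(a_1,\dots,a_r;q)_n := (a_1;q)_n\cdots(a_r;q)_n$. The Jacobi theta function is $$\theta(z;q) := (-z,-z^{-1}q,q;q)_\infty = \sum_{k\in\mathbb{Z}} z^k q^{k(k-1)/2}.$$ *)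

(* Defs.v *)
From HB Require Import structures.
From mathcomp Require Import all_boot all_order all_algebra finmap.
From mathcomp Require Import boolp classical_sets functions cardinality fsbigop.
From mathcomp.multinomials Require Import monalg.

Set Implicit Arguments.
Unset Strict Implicit.
Unset Printing Implicit Defensive.

Import Order.TTheory GRing.Theory Num.Theory.
Local Open Scope ring_scope.

(* Laurent polynomials in one variable over the integers: finitely supported *)
(* functions int -> int, with the convolution product.  monalg provides the  *)
(* additive structure for any choiceType of exponents, but its ring          *)
(* structure needs a monoid of exponents without nontrivial units, which     *)
(* int is not.                                                               *)

Definition laurent : Type := {malg int[int]}.

HB.instance Definition _ := GRing.Zmodule.on laurent.

Section LaurentRing.
Local Open Scope fset_scope.
Implicit Types (f g h : laurent) (c d i j : int).

Definition lmono c i : laurent := << c *g i >>.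

Definition lmul f g : laurent :=
  \sum_(i <- msupp f) \sum_(j <- msupp g) lmono (f@_i * g@_j) (i + j).

Fact lmono0 i : lmono 0 i = 0. Proof. exact: monalgU0. Qed.

Fact lmulw (A B : {fset int}) f g : msupp f `<=` A -> msupp g `<=` B ->
  lmul f g = \sum_(i <- A) \sum_(j <- B) lmono (f@_i * g@_j) (i + j).
Proof.
move=> fA gB; rewrite /lmul (big_fset_incl _ fA) /=.
  apply/eq_bigr=> i _; apply/big_fset_incl => // j _ /mcoeff_outdom ->.
  by rewrite mulr0 lmono0.
move=> i _ /mcoeff_outdom fi0.
by rewrite big1 => // j _; rewrite fi0 mul0r lmono0.
Qed.

Fact lmulC : commutative lmul.
Proof.
move=> f g; rewrite /lmul exchange_big; apply/eq_bigr=> i _.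
by apply/eq_bigr=> j _; rewrite mulrC addrC.
Qed.

Fact lmulDl : left_distributive lmul +%R.
Proof.
move=> f1 f2 g.
rewrite (lmulw (msuppD_le f1 f2) (fsubset_refl _)).
rewrite (lmulw (fsubsetUl _ (msupp f2)) (fsubset_refl (msupp g))).
rewrite (lmulw (fsubsetUr (msupp f1) _) (fsubset_refl (msupp g))).
rewrite -big_split /=; apply/eq_bigr=> i _.
rewrite -big_split /=; apply/eq_bigr=> j _.
by rewrite mcoeffD mulrDl /lmono monalgUD.
Qed.

Fact lmul0l : left_zero 0 lmul.
Proof. by move=> g; rewrite /lmul msupp0 big_seq_fset0. Qed.

Fact lmulUU c d i j : lmul (lmono c i) (lmono d j) = lmono (c * d) (i + j).
Proof. by rewrite (lmulw msuppU_le msuppU_le) !big_seq_fset1 !mcoeffUU. Qed.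

Fact lmul_suml I (r : seq I) (F : I -> laurent) g :
  lmul (\sum_(x <- r) F x) g = \sum_(x <- r) lmul (F x) g.
Proof. exact: (big_morph (lmul^~ g) (fun _ _ => lmulDl _ _ _) (lmul0l _)). Qed.

Fact lmul_sumr I (r : seq I) (F : I -> laurent) g :
  lmul g (\sum_(x <- r) F x) = \sum_(x <- r) lmul g (F x).
Proof.
by rewrite lmulC lmul_suml; apply/eq_bigr=> x _; rewrite lmulC.
Qed.

Fact lmulEl f g : lmul f g = \sum_(i <- msupp f) lmul (lmono f@_i i) g.
Proof. by rewrite {1}[f]monalgE lmul_suml. Qed.

Fact lmulEr f g : lmul f g = \sum_(j <- msupp g) lmul f (lmono g@_j j).
Proof. by rewrite {1}[g]monalgE lmul_sumr. Qed.

Fact lmulA : associative lmul.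
Proof.
move=> f g h; rewrite (lmulEl f (lmul g h)) (lmulEl f g).
rewrite (lmul_suml _ (fun i => lmul (lmono f@_i i) g)); apply/eq_bigr=> i _.
rewrite (lmulEl g h) (lmulEr _ g) lmul_sumr.
rewrite (lmul_suml _ (fun j => lmul _ (lmono g@_j j))); apply/eq_bigr=> j _.
rewrite (lmulEr _ h) (lmulEr (lmul _ _) h) lmul_sumr; apply/eq_bigr=> k _.
by rewrite !lmulUU mulrA addrA.
Qed.

Fact lmul1l : left_id (lmono 1 0) lmul.
Proof.
move=> f; rewrite [f]monalgE lmul_sumr; apply/eq_bigr=> i _.
by rewrite lmulUU mul1r add0r.
Qed.

Fact lmono1_neq0 : lmono 1 0 != 0.
Proof. by rewrite monalgU_eq0. Qed.

HB.instance Definition _ := GRing.Zmodule_isComNzRing.Build laurent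
  lmulA lmulC lmul1l lmulDl lmono1_neq0.

Definition lunit : pred laurent := fun f => `[< exists g, g * f = 1 >].

Definition linv f : laurent :=
  if lunit f then xget 0 [set g | g * f = 1] else f.

Fact lmulVr : {in lunit, left_inverse 1 linv *%R}.
Proof.
move=> f; rewrite -topredE /= /linv => uf; rewrite uf.
by move/asboolP: uf => [g gf]; case: xgetP => [h _ //|/(_ g)].
Qed.

Fact lunitP f g : g * f = 1 -> lunit f.
Proof. by move=> gf; apply/asboolP; exists g. Qed.

Fact linv_out : {in [predC lunit], linv =1 id}.
Proof. by move=> f; rewrite !inE /linv -topredE /= => /negbTE ->. Qed.

HB.instance Definition _ := GRing.ComNzRing_hasMulInverse.Build laurent
  lmulVr lunitP linv_out.

End LaurentRing.

Definition t : laurent := lmono 1 1.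

(* Formal power series over a commutative ring, with the Cauchy product.     *)

Record fps (R : Type) := Fps { fps_coef :> nat -> R }.

Section FpsRing.
Variable R : comNzRingType.
Implicit Types f g h : fps R.

HB.instance Definition _ := gen_eqMixin (fps R).
HB.instance Definition _ := gen_choiceMixin (fps R).

Fact fpsP f g : (forall n, f n = g n) <-> f = g.
Proof.
by split=> [|->//]; case: f g => [f] [g] fg; congr Fps; apply/funext.
Qed.

Definition fps_opp f := Fps (fun n => - f n).
Definition fps_add f g := Fps (fun n => f n + g n).
Definition fps_mul f g := Fps (fun n => \sum_(i < n.+1) f i * g (n - i)%N).
Definition fpsC (c : R) := Fps (fun n => if n is 0%N then c else 0).
Definition fpsX := Fps (fun n => (n == 1%N)%:R : R).

Fact fps_addA : associative fps_add.
Proof. by move=> f g h; apply/fpsP => n /=; rewrite addrA. Qed.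
Fact fps_addC : commutative fps_add.
Proof. by move=> f g; apply/fpsP => n /=; rewrite addrC. Qed.
Fact fps_add0 : left_id (fpsC 0) fps_add.
Proof. by move=> f; apply/fpsP => -[|n] /=; rewrite add0r. Qed.
Fact fps_addN : left_inverse (fpsC 0) fps_opp fps_add.
Proof. by move=> f; apply/fpsP => -[|n] /=; rewrite addNr. Qed.

HB.instance Definition _ := GRing.isZmodule.Build (fps R)
  fps_addA fps_addC fps_add0 fps_addN.

Let trunc n f := \poly_(i < n.+1) f i.

Let fps_mul_trunc N n f g :
  (n <= N)%N -> fps_mul f g n = (trunc N f * trunc N g)`_n.
Proof.
move=> nN; rewrite coefM; apply: eq_bigr => i _; rewrite !coef_poly !ltnS.
by rewrite (leq_trans _ nN) ?(leq_trans (leq_subr _ _) nN) // -ltnS.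
Qed.

Let truncM N n f g : (n <= N)%N ->
  (trunc N (fps_mul f g))`_n = (trunc N f * trunc N g)`_n.
Proof. by move=> nN; rewrite coef_poly ltnS nN (fps_mul_trunc _ _ nN). Qed.

Fact fps_mulC : commutative fps_mul.
Proof.
by move=> f g; apply/fpsP => n; rewrite !(fps_mul_trunc _ _ (leqnn n)) mulrC.
Qed.

Fact fps_mulA : associative fps_mul.
Proof.
move=> f g h; apply/fpsP => n; rewrite !(fps_mul_trunc _ _ (leqnn n)).
transitivity ((trunc n f * (trunc n g * trunc n h))`_n).
  by rewrite !(coefM (trunc n f)); apply: eq_bigr => i _; rewrite truncM ?leq_subr.
rewrite mulrA [LHS]coefM [RHS]coefM.
by apply: eq_bigr => i _; rewrite truncM // -ltnS.
Qed.

Fact fps_mul1 : left_id (fpsC 1) fps_mul.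
Proof.
move=> f; apply/fpsP => n /=; rewrite big_ord_recl /= mul1r subn0.
by rewrite big1 ?addr0 // => i _; rewrite mul0r.
Qed.

Fact fps_mulDl : left_distributive fps_mul fps_add.
Proof.
move=> f g h; apply/fpsP => n /=; rewrite -big_split /=.
by apply: eq_bigr => i _; rewrite mulrDl.
Qed.

Fact fps_one_neq0 : fpsC 1 != 0.
Proof. by apply/eqP => /fpsP/(_ 0%N) /eqP; rewrite oner_eq0. Qed.

HB.instance Definition _ := GRing.Zmodule_isComNzRing.Build (fps R)
  fps_mulA fps_mulC fps_mul1 fps_mulDl fps_one_neq0.

(* Limit in R[[X]] for the X-adic topology over discrete R: each coefficient *)
(* is eventually constant (junk value 0 for a coefficient that is not).      *)
Definition fps_lim (u : nat -> fps R) : fps R :=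
  Fps (fun n => xget 0 [set c | exists N, forall m, (N <= m)%N -> u m n = c]).

Definition fps_sum (F : nat -> fps R) : fps R :=
  fps_lim (fun N => \sum_(k < N) F k).

(* (a; q)_n and (a; q)_oo *)
Definition qpoch (a q : fps R) (n : nat) : fps R :=
  \prod_(j < n) (1 - a * q ^+ j).
Definition qpoch_inf (a q : fps R) : fps R := fps_lim (qpoch a q).

End FpsRing.

Arguments fpsX {R}.

(* theta c a b is theta(z; q^b) for z = c q^a, with c invertible and a <= b: *)
(* since z^-1 is not a power series, the argument z^-1 q^b of the product    *)
(* (-z, -z^-1 q^b, q^b; q^b)_oo is written c^-1 q^(b - a).                   *)
Definition theta (R : comUnitRingType) (c : R) (a b : nat) : fps R :=
  qpoch_inf (- (fpsC c * fpsX ^+ a)) (fpsX ^+ b) *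
  qpoch_inf (- (fpsC c^-1 * fpsX ^+ (b - a))) (fpsX ^+ b) *
  qpoch_inf (fpsX ^+ b) (fpsX ^+ b).

Definition q : fps laurent := fpsX.

Definition is_partition (l : seq nat) : bool := sorted geq l && (0%N \notin l).

Definition gap3 (l : seq nat) : Prop :=
  sorted (fun a b => b + 2 <= a)%N l /\
  {in l &, forall a b : nat,
     (a = b + 2 \/ a = b + 3)%N -> (3 %| a + b)%N}.

Definition nu (j : nat) (l : seq nat) : nat := count (fun a => a == j %[mod 3]) l.

(* The sum over the (finitely many) partitions of size n is a finitely       *)
(* supported sum over all sequences of natural numbers.                      *)
Definition C (m : nat) : fps laurent :=
  Fps (fun n => \sum_(l \in [set l : seq nat |
                   [/\ is_partition l, gap3 l, all (leq m) l & sumn l = n]])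
                  t ^ ((nu 1 l)%:Z - (nu 2 l)%:Z)).

Definition C2star : fps laurent := C 1 - C 2 + C 3.

Definition legendre (a p : nat) : int :=
  if (p %| a)%N then 0
  else if [exists x : 'I_p, x ^ 2 == a %[mod p]]%N then 1 else -1.

Definition chi3 (m : nat) : int := legendre (m + 1) 3.

Definition Theta1 : fps laurent :=
  fps_sum (fun k => fpsC ((chi3 k)%:~R * t ^ (- k%:Z)) * q ^+ (k * (k + 1))).

Definition Theta2 : fps laurent :=
  fps_sum (fun k => fpsC ((chi3 k)%:~R * t ^ k%:Z) * q ^+ (k ^ 2)).

(* Main.v *)
(** Let sigma be the substitution t -> t q^3, and put a_k = C_{3k+3},
    c_k = C_{3k+2}.  Removing the smallest part gives a linear recurrence in k
    for (a_k, c_k), which together with a_k, c_k -> 1 determines both sequences.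
    The point is that the recurrence is gauge equivalent to its image under
    sigma: for all k,
      c_k = sigma(a_k) + t q^{3k+4} sigma(c_{k+1}),
      t q sigma(a_k) = a_k + (t q - 1) c_{k+1}.
    At k = 0 these relations give q-difference equations in t for C_2, C_2^* and
    C_3.  Hence C_2 = K theta(t q^4; q^6) and C_2^* = K theta(t q; q^6) with K free
    of t, and the leading coefficients of C_2 as the power of t grows yield
    K = 1 / (q^3; q^3)_oo.  The equation for C_3 is
      t^2 q^2 sigma(C_3) = C_3 - (1 - t q) C_2^*,
    and it has only one solution whose coefficients decay as fast as those of
    C_3.  The right-hand side of the theorem satisfies the same equation and has
    the same decay, because the product (-q^3; q^3)_oo theta(-t^2 q^2; q^6) equals
    C_2 times the bilateral completion of Theta_1, an instance of the quintuple
    product identity, which is obtained here from the Jacobi triple product and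
    the pentagonal number theorem.  *)

Require Import Defs.
From mathcomp Require Import all_boot all_order all_algebra zify ring.
From mathcomp Require Import finmap boolp classical_sets functions cardinality
  fsbigop.
From mathcomp.multinomials Require Import monalg.

Set Implicit Arguments.
Unset Strict Implicit.
Unset Printing Implicit Defensive.

Import Order.TTheory GRing.Theory Num.Theory.
Local Open Scope ring_scope.

(** * Formal power series *)

Section Fps.
Variable R : comNzRingType.
Implicit Types (f g h : fps R) (c : R).

Lemma coef_fpsM f g n : (f * g) n = \sum_(i < n.+1) f i * g (n - i)%N.
Proof. by []. Qed.

Lemma coef_fps_sum (I : Type) (r : seq I) (P : pred I) (F : I -> fps R) n :
  (\sum_(i <- r | P i) F i) n = \sum_(i <- r | P i) F i n.
Proof. by apply: (big_morph (fun f : fps R => f n)) => //; case: n. Qed.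

Lemma coef_fpsCM c f n : (fpsC c * f) n = c * f n.
Proof.
rewrite coef_fpsM big_ord_recl subn0 big1 ?addr0 // => i _.
by rewrite mul0r.
Qed.

Lemma fpsCM c d : fpsC (c * d) = fpsC c * fpsC d :> fps R.
Proof. by apply/fpsP => -[|n]; rewrite coef_fpsCM //= mulr0. Qed.

Lemma fpsCN c : fpsC (- c) = - fpsC c :> fps R.
Proof. by apply/fpsP => -[|n] //=; rewrite oppr0. Qed.

Lemma fpsC1 : fpsC 1 = 1 :> fps R. Proof. by []. Qed.

Lemma fpsCX c k : fpsC (c ^+ k) = fpsC c ^+ k :> fps R.
Proof. by elim: k => // k IHk; rewrite !exprS fpsCM IHk. Qed.

Lemma coef_fpsXM f n : (fpsX * f) n = if n is n'.+1 then f n' else 0.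
Proof.
rewrite coef_fpsM; case: n => [|n]; first by rewrite big_ord1 mul0r.
rewrite 2!big_ord_recl /= mul0r add0r mul1r subn1 big1 ?addr0 // => i _.
by rewrite mul0r.
Qed.

Lemma coef_fpsXnM m f n : (fpsX ^+ m * f) n = if (m <= n)%N then f (n - m)%N else 0.
Proof.
elim: m n => [|m IHm] n; first by rewrite mul1r subn0.
rewrite exprS -mulrA coef_fpsXM; case: n => [|n]; first by [].
by rewrite IHm ltnS subSS.
Qed.

Lemma fpsXnI m : injective (fun f : fps R => fpsX ^+ m * f).
Proof.
move=> f g /fpsP fg; apply/fpsP => n.
by have := fg (m + n)%N; rewrite !coef_fpsXnM leq_addr addKn.
Qed.

Definition fps_eqmod N f g := forall n, (n < N)%N -> f n = g n.

Lemma fps_eqmod_refl N f : fps_eqmod N f f. Proof. by []. Qed.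

Lemma fps_eqmod_sym N f g : fps_eqmod N f g -> fps_eqmod N g f.
Proof. by move=> fg n /fg. Qed.

Lemma fps_eqmod_trans N f g h :
  fps_eqmod N f g -> fps_eqmod N g h -> fps_eqmod N f h.
Proof. by move=> fg gh n nN; rewrite fg ?gh. Qed.

Lemma fps_eqmodW M N f g : (M <= N)%N -> fps_eqmod N f g -> fps_eqmod M f g.
Proof. by move=> MN fg n nM; apply: fg; apply: leq_trans MN. Qed.

Lemma fps_eqmodD N f f' g g' :
  fps_eqmod N f f' -> fps_eqmod N g g' -> fps_eqmod N (f + g) (f' + g').
Proof. by move=> ff' gg' n nN /=; rewrite ff' ?gg'. Qed.

Lemma fps_eqmodM N f f' g g' :
  fps_eqmod N f f' -> fps_eqmod N g g' -> fps_eqmod N (f * g) (f' * g').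
Proof.
move=> ff' gg' n nN; rewrite !coef_fpsM; apply: eq_bigr => i _.
rewrite ff' ?gg' //; first exact: leq_ltn_trans (leq_subr _ _) nN.
by apply: leq_ltn_trans nN; rewrite -ltnS.
Qed.

Lemma fps_eqmod_sum N (I : eqType) (r : seq I) (F G : I -> fps R) :
  {in r, forall i, fps_eqmod N (F i) (G i)} ->
  fps_eqmod N (\sum_(i <- r) F i) (\sum_(i <- r) G i).
Proof.
by move=> FG n nN; rewrite !coef_fps_sum; apply: eq_big_seq => i /FG ->.
Qed.

Lemma fps_eqmodXnM M N f g :
  fps_eqmod N f g -> fps_eqmod (M + N) (fpsX ^+ M * f) (fpsX ^+ M * g).
Proof.
by move=> fg n nMN; rewrite !coef_fpsXnM; case: leqP => // Mn; apply: fg; lia.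
Qed.

Lemma fps_eqmodP f g : (forall N, fps_eqmod N f g) -> f = g.
Proof. by move=> fg; apply/fpsP => n; apply: (fg n.+1). Qed.

(** Since [f] has constant term 1, each coefficient of the second factor is determined by the
    product and the lower coefficients. *)
Lemma fps_eqmod_mulfI N f g h : f 0%N = 1 ->
  fps_eqmod N (f * g) (f * h) -> fps_eqmod N g h.
Proof.
move=> f0 fgh; elim/ltn_ind => n IHn nN.
have := fgh n nN; rewrite !coef_fpsM !big_ord_recl !subn0 f0 !mul1r /=.
rewrite (eq_bigr (fun i : 'I_n => f (bump 0 i) * h (n - bump 0 i)%N)); last first.
  by move=> i _; rewrite (IHn (n - bump 0 i)%N) //=; have := ltn_ord i;
    rewrite /bump leq0n add1n; lia.
exact: addIr.
Qed.

Lemma fps_limE (u : nat -> fps R) f :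
  (forall n, exists N, forall m, (N <= m)%N -> u m n = f n) -> fps_lim u = f.
Proof.
move=> uf; apply/fpsP => n /=; have [N uN] := uf n.
case: xgetP => [c -> [M uM]|/(_ (f n))]; last by case; exists N.
by rewrite -(uM (maxn M N)) ?uN // leq_max leqnn ?orbT.
Qed.

Lemma qpoch0 (a q : fps R) : qpoch a q 0 = 1.
Proof. exact: big_ord0. Qed.

Lemma qpochS (a q : fps R) n : qpoch a q n.+1 = qpoch a q n * (1 - a * q ^+ n).
Proof. by rewrite /qpoch big_ord_recr. Qed.

Lemma qpoch_stable (a : fps R) b N m : (0 < b)%N -> (N <= m)%N ->
  fps_eqmod N (qpoch a (fpsX ^+ b) m) (qpoch a (fpsX ^+ b) N).
Proof.
move=> b0; elim: m => [|m IHm]; first by rewrite leqn0 => /eqP ->.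
rewrite leq_eqVlt => /predU1P[-> //|Nm].
rewrite qpochS -[X in fps_eqmod _ _ X]mulr1.
apply: fps_eqmodM; first exact: IHm.
move=> n nN; rewrite -[RHS]addr0; congr (_ + _).
rewrite -exprM mulrC -[LHS]/(- (fpsX ^+ (b * m) * a) n) coef_fpsXnM ifN ?oppr0 //.
by rewrite -ltnNge; apply: leq_trans nN _; nia.
Qed.

Lemma qpoch_infE (a : fps R) b N : (0 < b)%N ->
  fps_eqmod N (qpoch_inf a (fpsX ^+ b)) (qpoch a (fpsX ^+ b) N).
Proof.
move=> b0; rewrite /qpoch_inf.
rewrite (@fps_limE _ (Fps (fun n => qpoch a (fpsX ^+ b) n.+1 n))).
  by move=> n nN; rewrite (qpoch_stable _ b0 nN).
by move=> n; exists n.+1 => m nm /=; apply: (qpoch_stable _ b0 nm).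
Qed.

End Fps.

(** * The Jacobi triple product *)

Section QBinomial.
Variables (R : comNzRingType) (Q : R).

Fixpoint qbin n k : R :=
  match n, k with
  | _, 0%N => 1
  | 0%N, _.+1 => 0
  | n'.+1, k'.+1 => qbin n' k' + Q ^+ k'.+1 * qbin n' k'.+1
  end.

Lemma qbin0 n : qbin n 0 = 1. Proof. by case: n. Qed.

Lemma qbin_small n k : (n < k)%N -> qbin n k = 0.
Proof.
elim: n k => [|n IHn] [|k] //= nk.
by rewrite !IHn ?mulr0 ?addr0 // ltnW.
Qed.

(** The quotient formula with denominators cleared. The induction rests on 1 - Q^(k+m+2) = (1 -
    Q^(k+1)) + Q^(k+1) (1 - Q^(m+1)). *)
Lemma qbin_prod k m :
  \prod_(j < k) (1 - Q ^+ j.+1) * \prod_(j < m) (1 - Q ^+ j.+1) * qbin (k + m) k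
  = \prod_(j < k + m) (1 - Q ^+ j.+1).
Proof.
move en: (k + m)%N => n; elim: n k m en => [|n IHn] [|k] [|m] // en.
- by rewrite !big_ord0 !mulr1.
- by rewrite big_ord0 mul1r mulr1 -en.
- rewrite big_ord0 mulr1 /= (@qbin_small n k.+1); last by lia.
  have ek : k = n by lia.
  have := IHn k 0%N; rewrite addn0 big_ord0 mulr1 => /(_ ek) E.
  by rewrite mulr0 addr0 !big_ord_recr /= mulrAC E ek.
have en1 : (k + m.+1)%N = n by lia.
have en2 : (k.+1 + m)%N = n by lia.
have := IHn _ _ en1; have := IHn _ _ en2.
rewrite [X in _ -> _ -> _ = X]big_ord_recr /=.
have -> : Q ^+ n.+1 = Q ^+ k.+1 * Q ^+ m.+1 by rewrite -exprD; congr (_ ^+ _); lia.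
rewrite /= big_ord_recr [\prod_(j < m.+1) _]big_ord_recr /= => E2 E1.
rewrite (_ : 1 - _ * _ = (1 - Q ^+ k.+1) + Q ^+ k.+1 * (1 - Q ^+ m.+1));
  last by ring.
by rewrite [RHS]mulrDr -{1}E1 -E2; ring.
Qed.

(** The q-binomial theorem in homogeneous form: taking [u] = Q^N later centres the sum at index
    N. *)
Lemma qbinomial (u w : R) n :
  \prod_(j < n) (u + w * Q ^+ j) =
  \sum_(k < n.+1) qbin n k * Q ^+ 'C(k, 2) * w ^+ k * u ^+ (n - k).
Proof.
elim: n w => [|n IHn] w; first by rewrite big_ord0 big_ord1 /= !mul1r.
rewrite big_ord_recl mulr1.
under eq_bigr => i _ do rewrite exprS mulrA.
rewrite IHn [RHS]big_ord_recl /= !mul1r.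
under [X in _ = _ + X]eq_bigr => i _ do
  rewrite /bump leq0n add1n subSS mulrDl mulrDl mulrDl.
rewrite big_split /= addrCA mulrDl [LHS]addrC; congr (_ + _).
  rewrite big_distrr /=; apply: eq_bigr => i _.
  by rewrite binS bin1 exprMn exprD exprS; ring.
rewrite big_ord_recl [in RHS]big_ord_recr /= add0n (@qbin_small n n.+1) //
  mulr0 !mul0r addr0.
rewrite qbin0 !expr0 !mul1r !subn0 mulrDr exprS; congr (_ + _).
rewrite big_distrr; apply: eq_bigr => i _ /=; rewrite /bump leq0n add1n.
have -> : u ^+ (n - i) = u * u ^+ (n - i.+1).
  by rewrite -exprS; congr (_ ^+ _); have := ltn_ord i; lia.
by rewrite exprMn; ring.
Qed.

End QBinomial.

Lemma bin2D m n : 'C(m + n, 2) = ('C(m, 2) + 'C(n, 2) + m * n)%N.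
Proof.
elim: n => [|n IHn]; first by rewrite bin0n muln0 !addn0.
by rewrite addnS !binS !bin1 IHn; lia.
Qed.

Lemma mul2bin2 n : (2 * 'C(n, 2) + n = n * n)%N.
Proof. by elim: n => // n IHn; rewrite binS bin1; lia. Qed.

Section FiniteTripleProduct.
Variables (R : comNzRingType) (X Y : R).

(* The term of index i - N of the theta series with z = X and base XY, where
   negative powers of X are expressed through Y. *)
Definition jterm N (i : nat) : R :=
  if (N <= i)%N then (X * Y) ^+ 'C(i - N, 2) * X ^+ (i - N)
  else (X * Y) ^+ 'C(N - i, 2) * Y ^+ (N - i).

(* The common factor cannot be cancelled in a general ring. *)
Lemma finite_triple_product_scaled N :
  (X * Y) ^+ ('C(N, 2) + N * N) * X ^+ N *
    (\prod_(j < N) (1 + X * (X * Y) ^+ j) * \prod_(j < N) (1 + Y * (X * Y) ^+ j)) =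
  (X * Y) ^+ ('C(N, 2) + N * N) * X ^+ N *
    \sum_(i < (N + N).+1) qbin (X * Y) (N + N) i * jterm N i.
Proof.
set Q := X * Y.
(* For j >= N the factor is Q^N (1 + X Q^(j-N)); for j < N it is X Q^j (1 + Y Q^(N-1-j)), because X
   Y = Q. *)
transitivity (\prod_(j < N + N) (Q ^+ N + X * Q ^+ j)).
  rewrite big_split_ord /=.
  under [X in _ = _ * X]eq_bigr => j _ do
    rewrite exprD mulrCA -{1}[Q ^+ N]mulr1 -mulrDr.
  rewrite big_split /= prodr_const card_ord -exprM.
  have -> : \prod_(j < N) (Q ^+ N + X * Q ^+ j) =
      Q ^+ 'C(N, 2) * X ^+ N * \prod_(j < N) (1 + Y * Q ^+ j).
    have -> : Q ^+ 'C(N, 2) = \prod_(j < N) Q ^+ j.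
      by rewrite -expr_sum -triangular_sum big_mkord.
    rewrite -[in X ^+ N](card_ord N) -prodr_const -big_split /=.
    rewrite [X in _ = _ * X](reindex_inj rev_ord_inj) -big_split /=.
    apply: eq_bigr => j _; rewrite mulrDr mulr1 [RHS]addrC mulrC; congr (_ + _).
    transitivity (Q ^+ j * Q * Q ^+ (N - j.+1)); last by rewrite /Q; ring.
    by rewrite -exprSr -exprD; congr (_ ^+ _); have := ltn_ord j; lia.
  by rewrite exprD; ring.
rewrite qbinomial big_distrr; apply: eq_bigr => -[i /= iN] _.
rewrite /jterm -/Q -!exprM mulrCA mulrA; case: leqP => Ni.
  have [d ei] : exists d, i = (N + d)%N by exists (i - N)%N; lia.
  have E : (('C(i, 2) + N * (N + N - i)) = 'C(N, 2) + N * N + 'C(d, 2))%N.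
    by rewrite ei bin2D; nia.
  rewrite ei addKn exprD -ei.
  transitivity (qbin Q (N + N) i * Q ^+ ('C(i, 2) + N * (N + N - i))
      * X ^+ N * X ^+ d).
    by rewrite [Q ^+ (_ + _)]exprD; ring.
  by rewrite E [Q ^+ (_ + _ + _)]exprD; ring.
have [d eN] : exists d, N = (i + d)%N by exists (N - i)%N; lia.
have E : (('C(i, 2) + N * (N + N - i)) = 'C(N, 2) + N * N + 'C(d, 2) + d)%N.
  by have := mul2bin2 d; rewrite eN bin2D; nia.
have -> : (N - i)%N = d by lia.
have -> : X ^+ N = X ^+ i * X ^+ d by rewrite -exprD -eN.
transitivity (qbin Q (N + N) i * Q ^+ ('C(i, 2) + N * (N + N - i)) * X ^+ i).
  by rewrite [Q ^+ (_ + _)]exprD; ring.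
have QX : Q ^+ d = X ^+ d * Y ^+ d by rewrite -exprMn.
by rewrite E ![Q ^+ (_ + _)]exprD QX; ring.
Qed.

End FiniteTripleProduct.

(** The exponent a k + b k (k - 1) / 2 of the theta series, split by sign so that, for a <= b, it is
    a natural number without truncation. *)
Definition theta_exp (a b : nat) (k : int) : nat :=
  match k with
  | Posz d => (a * d + b * 'C(d, 2))%N
  | Negz d => ((b - a) * d.+1 + b * 'C(d.+1, 2))%N
  end.

Lemma theta_expE a b k : (a <= b)%N ->
  2 * (theta_exp a b k)%:Z = 2 * a%:Z * k + b%:Z * (k * (k - 1)).
Proof.
move=> ab; case: k => d /=; first by have := mul2bin2 d; nia.
by have := mul2bin2 d.+1; rewrite NegzE; nia.
Qed.

Lemma theta_exp_ge a b k : (0 < a < b)%N -> (`|k| <= theta_exp a b k)%N.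
Proof. by case/andP=> a0 ab; case: k => d /=; nia. Qed.

Section TripleProduct.
Variables (R : comUnitRingType) (c : R) (a b : nat).
Hypotheses (c_unit : c \is a GRing.unit) (ab : (0 < a < b)%N).

Let X : fps R := fpsC c * fpsX ^+ a.
Let Y : fps R := fpsC c^-1 * fpsX ^+ (b - a).

Let XY : X * Y = fpsX ^+ b.
Proof.
rewrite /X /Y mulrACA -fpsCM mulrV // mul1r -exprD subnKC //.
by case/andP: ab => _ /ltnW.
Qed.

Let b_gt0 : (0 < b)%N. Proof. by case/andP: ab => a0; apply: ltn_trans. Qed.

Let triple_product N :
  qpoch (- X) (fpsX ^+ b) N * qpoch (- Y) (fpsX ^+ b) N =
  \sum_(i < (N + N).+1) qbin (fpsX ^+ b) (N + N) i * jterm X Y N i.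
Proof.
rewrite /qpoch; under eq_bigr do rewrite mulNr opprK.
under [X in _ * X]eq_bigr do rewrite mulNr opprK.
have := finite_triple_product_scaled X Y N; rewrite XY -exprM -!mulrA.
move=> /(@fpsXnI R _) E.
(* As [c] is a unit, the common factor X^N can be turned into a pure power of q, which cancels. *)
have XN : fpsC (c^-1 ^+ N) * X ^+ N = fpsX ^+ (a * N).
  by rewrite /X exprMn mulrA -fpsCX -fpsCM -exprMn mulVr // expr1n mul1r -exprM.
apply: (@fpsXnI R (a * N)); rewrite -XN -!mulrA; congr (_ * _).
by rewrite E.
Qed.

Let jtermE N (i : nat) : jterm X Y N i =
  fpsC (c ^ (i%:Z - N%:Z)) * fpsX ^+ theta_exp a b (i%:Z - N%:Z).
Proof.
rewrite /jterm XY; case: leqP => Ni.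
  rewrite subzn // /= -exprM /X exprMn -fpsCX -exprM exprD; ring.
have -> : i%:Z - N%:Z = Negz (N - i).-1 by lia.
have -> : c ^ Negz (N - i).-1 = c^-1 ^+ (N - i).
  by rewrite exprVn -{2}(@prednK (N - i)) ?subn_gt0.
rewrite /= prednK ?subn_gt0 // -exprM /Y exprMn -fpsCX -exprM exprD; ring.
Qed.

(** Multiplying the finite triple product by (q^b; q^b)_oo makes each central Gaussian binomial tend
    to 1. *)
Lemma theta_eqmod N : fps_eqmod N (theta c a b)
  (\sum_(i < (N + N).+1)
     fpsC (c ^ (i%:Z - N%:Z)) * fpsX ^+ theta_exp a b (i%:Z - N%:Z)).
Proof.
pose E : fps R := qpoch_inf (fpsX ^+ b) (fpsX ^+ b).
apply: (@fps_eqmod_trans _ _ _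
  (\sum_(i < (N + N).+1) E * qbin (fpsX ^+ b) (N + N) i * jterm X Y N i)).
  rewrite /theta mulrC -/E.
  under [X in fps_eqmod _ _ X]eq_bigr do rewrite -mulrA.
  rewrite -big_distrr -triple_product.
  by do 2! apply: fps_eqmodM => //; apply: qpoch_infE.
apply: fps_eqmod_sum => -[i /= iN] _.
rewrite jtermE mulrCA; apply: fps_eqmodM => //.
rewrite mulrC -[X in fps_eqmod _ _ X]mulr1.
set k := i%:Z - N%:Z.
(* The k-th term starts in degree at least |k|, so precision N - |k| suffices for its factor; both
   lower indices N + k and N - k of the binomial are at least that large. *)
apply: (@fps_eqmodW _ _ (theta_exp a b k + (N - `|k|))).
  by have := theta_exp_ge k ab; rewrite -/k; lia.
apply: fps_eqmodXnM.
apply: (fps_eqmod_mulfI (f := E)).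
  rewrite (@qpoch_infE _ (fpsX ^+ b) _ 1 b_gt0 0%N) // qpochS qpoch0 mul1r mulr1.
  by rewrite /= -[fpsX ^+ b]mulr1 coef_fpsXnM leqNgt b_gt0 subr0.
have Em m : (N - `|k| <= m)%N ->
    fps_eqmod (N - `|k|) E (qpoch (fpsX ^+ b) (fpsX ^+ b) m).
  by move=> le_m; apply: fps_eqmodW le_m _; apply: qpoch_infE.
have qE m : qpoch (fpsX ^+ b) (fpsX ^+ b) m =
    \prod_(j < m) (1 - (fpsX ^+ b : fps R) ^+ j.+1).
  by apply: eq_bigr => j _; rewrite exprS.
have := qbin_prod (fpsX ^+ b : fps R) i (N + N - i);
  rewrite subnKC // -!qE => prodE.
rewrite mulrA mulr1.
apply: fps_eqmod_trans (fps_eqmod_sym (Em (N + N)%N _)); last by lia.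
by rewrite -prodE; apply: fps_eqmodM => //; apply: fps_eqmodM; apply: Em; lia.
Qed.

End TripleProduct.

(** * Dissections of q-products and the pentagonal product *)

Section ProductIdentities.
Variable R : comUnitRingType.
Implicit Types x : fps R.

Lemma qpochNM x n : qpoch (- x) x n * qpoch x x n = qpoch (x ^+ 2) (x ^+ 2) n.
Proof.
rewrite -big_split; apply: eq_bigr => j _ /=.
by rewrite -[(x ^+ 2) ^+ j]exprM mulnC exprM; ring.
Qed.

Lemma qpoch_split3 x n : qpoch x x (3 * n) =
  qpoch (x ^+ 2) (x ^+ 3) n * qpoch x (x ^+ 3) n * qpoch (x ^+ 3) (x ^+ 3) n.
Proof.
elim: n => [|n IHn]; first by rewrite muln0 !qpoch0 !mulr1.
have -> : (3 * n.+1 = (3 * n).+3)%N by lia.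
by rewrite !qpochS IHn -!exprM !exprS; ring.
Qed.

Lemma qpoch_infNM b : (0 < b)%N ->
  qpoch_inf (- fpsX ^+ b) (fpsX ^+ b) * qpoch_inf (fpsX ^+ b) (fpsX ^+ b)
  = qpoch_inf (fpsX ^+ (b * 2)) (fpsX ^+ (b * 2)) :> fps R.
Proof.
move=> b0; apply: fps_eqmodP => N.
apply: fps_eqmod_trans (fps_eqmod_sym (qpoch_infE _ _)); last by lia.
by rewrite exprM -qpochNM; apply: fps_eqmodM; apply: qpoch_infE.
Qed.

(** The three products of this theta function collect the exponents b j with j congruent to 2, 1 and
    0 modulo 3. *)
Lemma theta_pentagonal b : (0 < b)%N ->
  theta (- 1) (b * 2) (b * 3) = qpoch_inf (fpsX ^+ b) (fpsX ^+ b) :> fps R.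
Proof.
move=> b0; apply: fps_eqmodP => N.
have b3 : (0 < b * 3)%N by lia.
apply: (@fps_eqmod_trans _ _ _ (qpoch (fpsX ^+ b) (fpsX ^+ b) (3 * N))); last first.
  by apply/fps_eqmod_sym/(@fps_eqmodW _ _ (3 * N)); [lia | apply: qpoch_infE].
rewrite qpoch_split3 /theta invrN invr1 fpsCN fpsC1 !mulN1r !opprK -!exprM.
have -> : (b * 3 - b * 2 = b)%N by lia.
by do 2! [apply: fps_eqmodM; last exact: qpoch_infE]; exact: qpoch_infE.
Qed.

End ProductIdentities.

(** * Coefficients of t^n q^N *)

Section LaurentCoefficients.
Implicit Types (f g : laurent) (h : fps laurent) (n N j : int).

Lemma lmonoM c d i j : lmono c i * lmono d j = lmono (c * d) (i + j).
Proof. exact: lmulUU. Qed.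

Lemma coef_lmono c i n : (lmono c i)@_n = c *+ (i == n).
Proof. exact: mcoeffU. Qed.

Lemma t_unit : t \is a GRing.unit.
Proof. by apply/unitrPr; exists (lmono 1 (- 1)); rewrite lmonoM mulr1 addrN. Qed.

Lemma tX (k : nat) : t ^+ k = lmono 1 k%:Z.
Proof.
elim: k => // k IHk; rewrite exprS IHk lmonoM mulr1; congr lmono; lia.
Qed.

Lemma texp j : t ^ j = lmono 1 j.
Proof.
case: j => k; first exact: tX.
rewrite NegzE -exprnN; apply: (mulrI (unitrX k.+1 t_unit)).
by rewrite mulrV ?unitrX ?t_unit // tX lmonoM mulr1 addrN.
Qed.

Lemma coef_texpM j f n : (t ^ j * f)@_n = f@_(n - j).
Proof.
rewrite texp {1 2}[f]monalgE mulr_sumr !raddf_sum /=; apply: eq_bigr => i _.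
by rewrite lmonoM mul1r !coef_lmono; congr (_ *+ nat_of_bool _); lia.
Qed.

(* The coefficient of t^n q^N, extended by 0 to negative N. *)
Definition tq_coef h n N : int := if N is Posz m then (h m)@_n else 0.

Lemma tq_coefP h h' : tq_coef h =2 tq_coef h' -> h = h'.
Proof.
by move=> hh'; apply/fpsP => m; apply/malgP => n; apply: (hh' n (Posz m)).
Qed.

Lemma tq_coefD h h' n N : tq_coef (h + h') n N = tq_coef h n N + tq_coef h' n N.
Proof. by case: N => m /=; rewrite ?addr0 // mcoeffD. Qed.

Lemma tq_coefN h n N : tq_coef (- h) n N = - tq_coef h n N.
Proof. by case: N => m /=; rewrite ?oppr0 // mcoeffN. Qed.

Lemma tq_coef_sum (I : Type) (r : seq I) (F : I -> fps laurent) n N :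
  tq_coef (\sum_(i <- r) F i) n N = \sum_(i <- r) tq_coef (F i) n N.
Proof.
apply: (big_morph (fun h => tq_coef h n N)) => [h h'|]; first exact: tq_coefD.
by case: N => // -[|m]; apply: mcoeff0.
Qed.

Lemma tq_coef_XnM m h n N : tq_coef (fpsX ^+ m * h) n N = tq_coef h n (N - m%:Z).
Proof.
case: N => N; last by case: m => // m.
rewrite {1}/tq_coef coef_fpsXnM; case: leqP => mN; first by rewrite subzn.
have -> : N%:Z - m%:Z = Negz (m - N).-1 by lia.
exact: mcoeff0.
Qed.

Lemma tq_coef_texpM j h n N : tq_coef (fpsC (t ^ j) * h) n N = tq_coef h (n - j) N.
Proof. by case: N => N //; rewrite /tq_coef coef_fpsCM coef_texpM. Qed.

Lemma tq_coef_intM z h n N : tq_coef (fpsC z%:~R * h) n N = z * tq_coef h n N.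
Proof.
case: N => N; last by rewrite mulr0.
by rewrite /tq_coef coef_fpsCM mulrzl raddfMz /= -mulrzl intz.
Qed.

Lemma tq_coef_eqmod M h h' n N : fps_eqmod M h h' -> N < M%:Z ->
  tq_coef h n N = tq_coef h' n N.
Proof. by case: N => //= N hh' NM; rewrite hh'. Qed.

End LaurentCoefficients.

(** * Partitions with the level 3 gap condition *)

Section GapPartitions.

(** Imposed on all pairs, not only on neighbours, so that appending a smallest part is a condition
    on each other part separately. *)
Definition gap_rel (a b : nat) : bool :=
  (b + 2 <= a)%N && ((a == b + 2)%N || (a == b + 3)%N ==> (3 %| a + b)%N).

Lemma mem_sumn l a : a \in l -> (a <= sumn l)%N.
Proof.
elim: l => //= b l IHl; rewrite inE => /predU1P[->|/IHl]; first exact: leq_addr.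
by move=> le_a; apply: leq_trans le_a (leq_addl _ _).
Qed.

Lemma pairwise_mem (r : rel nat) l a b :
  pairwise r l -> a \in l -> b \in l -> a != b -> r a b \/ r b a.
Proof.
elim: l => //= c l IHl /andP[/allP cl pl].
rewrite !inE => /predU1P[->|al] /predU1P[->|bl]; rewrite ?eqxx //.
- by left; apply: cl.
- by right; apply: cl.
- exact: IHl.
Qed.

Lemma gap_relP l : pairwise gap_rel l /\ 0%N \notin l <-> is_partition l /\ gap3 l.
Proof.
have gt2_trans : transitive (fun a b => b + 2 <= a)%N by move=> a b c /=; lia.
split=> [[pl l0]|[/andP[_ l0] [sl dl]]].
  have pl2 : pairwise (fun a b => b + 2 <= a)%N l.
    by apply: sub_pairwise pl => a b /andP[].
  split; first rewrite /is_partition l0 andbT; last split.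
  - by apply: sub_sorted (pairwise_sorted pl2) => a b /=; lia.
  - exact: pairwise_sorted.
  - move=> a b al bl ab; have : gap_rel a b; last first.
      by case/andP=> _ /implyP; apply; case: ab => ->; rewrite eqxx ?orbT.
    have [] : gap_rel a b \/ gap_rel b a; last by case/andP; lia.
      by apply: pairwise_mem pl al bl _; lia.
    by [].
split=> //; move: sl; rewrite sorted_pairwise // => sl.
apply: sub_in_pairwise (allss l) sl => a b al bl ab.
by rewrite /gap_rel ab; apply/implyP => /orP ab'; apply: dl => //;
  case: ab' => /eqP; [left | right].
Qed.

Definition weight (l : seq nat) : int := (nu 1 l)%:Z - (nu 2 l)%:Z.

Lemma weight_rcons l m : weight (rcons l m) = weight l + weight [:: m].
Proof. by rewrite /weight /nu -cats1 !count_cat !PoszD; lia. Qed.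

(** An arbitrary [p] is allowed because the parts compatible with a smallest part 2 modulo 3 do not
    form an interval. *)
Definition gap_set (p : pred nat) N : set (seq nat) :=
  [set l | [/\ pairwise gap_rel l, 0%N \notin l, all p l & sumn l = N]].

Definition gap_gf (p : pred nat) : fps laurent :=
  Fps (fun N => \sum_(l \in gap_set p N) t ^ weight l).

Lemma C_gap_gf m : C m = gap_gf (leq m).
Proof.
apply/fpsP => N /=; apply: eq_fsbigl; apply/seteqP; split=> l /= [].
  by move=> pl gl al sl; have /gap_relP[] := conj pl gl; split.
by move=> pl l0 al sl; have /gap_relP[] := conj pl l0; split.
Qed.

Lemma gap_set_finite p N : finite_set (gap_set p N).
Proof.
pose f (b : N.-bseq 'I_N.+1) : seq nat := map val b.
apply: (@sub_finite_set _ _ (f @` setT)); last exact: finite_image.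
move=> l [_ l0 _ sl].
have size_l : (size l <= N)%N.
  by rewrite -sl; elim: l l0 {sl} => //= a l IHl;
    rewrite inE negb_or => /andP[a0 /IHl]; lia.
have le_l a : a \in l -> (a < N.+1)%N.
  by rewrite -sl ltnS; apply: mem_sumn.
have size_l' : (size (map inord l : seq 'I_N.+1) <= N)%N by rewrite size_map.
exists (Bseq size_l') => //; rewrite /f /= -map_comp map_id_in // => a /le_l aN.
by rewrite /= inordK.
Qed.

(** Either [m] does not occur, or it is the last entry, and deleting it leaves exactly the
    partitions with parts in [p2]. *)
Lemma gap_gf_last (p p1 p2 : pred nat) m : (0 < m)%N ->
  (forall a, p a = (a == m) || p1 a) -> (forall a, p1 a -> (m < a)%N) ->
  (forall a, p2 a = p1 a && gap_rel a m) ->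
  gap_gf p = gap_gf p1 + fpsC (t ^ weight [:: m]) * (fpsX ^+ m * gap_gf p2).
Proof.
move=> m0 pE p1m p2E; apply/fpsP => N.
rewrite -[RHS]/(_ + (fpsC _ * _) N) coef_fpsCM coef_fpsXnM.
rewrite [LHS](fsbigID [set l | all p1 l] _ _ (gap_set_finite _ _)); congr (_ + _).
  apply: eq_fsbigl; apply/seteqP; split=> l /=; first by case=> -[].
  case=> pl l0 al sl; split=> //; split=> //.
  by apply: sub_all al => a; rewrite pE => ->; rewrite orbT.
case: leqP => mN; last first.
  rewrite mulr0 fsbig1 // => l [[pl l0 al sl] /negP/allPn[a al' /negbTE ap1]].
  have := allP al a al'; rewrite pE ap1 orbF => /eqP am.
  by have := mem_sumn al'; rewrite sl am; lia.
rewrite /= (fsbig_finite _ _ (gap_set_finite _ _)) mulr_sumr -fsbig_finite;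
  last exact: gap_set_finite.
rewrite [LHS](reindex_fsbig (rcons^~ m) (gap_set p2 (N - m))); last first.
  split=> [l [pl l0 al sl]||l [[pl l0 al sl] /negP/allPn[a al' /negbTE ap1]]].
  - have al1 : all p1 l by apply: sub_all al => a; rewrite p2E => /andP[].
    have alm : all (gap_rel^~ m) l by apply: sub_all al => a;
      rewrite p2E => /andP[].
    split; first split.
    + by rewrite pairwise_rcons alm.
    + by rewrite mem_rcons inE negb_or l0 andbT; lia.
    + rewrite all_rcons pE eqxx /=.
      by apply: sub_all al1 => a; rewrite pE => ->; rewrite orbT.
    + by rewrite sumn_rcons sl; lia.
    + by rewrite /= all_rcons; case/andP=> /p1m; rewrite ltnn.
  - by move=> l l' _ _; apply: rcons_injl.
  have := allP al a al'; rewrite pE ap1 orbF => /eqP am; subst a.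
  (* The list is decreasing and no part is below [m], so its last entry [x] must be [m]. *)
  case/lastP: l => // l x in pl l0 al sl al' *.
  move: pl l0 al; rewrite pairwise_rcons mem_rcons all_rcons inE negb_or.
  case/andP=> /allP lx pl /andP[_ l0] /andP[px /allP pal].
  have xm : x = m.
    move: al'; rewrite mem_rcons inE => /predU1P[//|/lx/andP[lexm _]].
    by move: px; rewrite pE => /predU1P[//|/p1m]; lia.
  subst x; exists l => //; split=> //.
    apply/allP => a aal; rewrite p2E lx // andbT; have := pal _ aal; rewrite pE.
    by case: eqP => // am _; have /andP[] := lx _ aal; rewrite am; lia.
  by rewrite -sl sumn_rcons addnK.
by apply: eq_fsbigr => l _; rewrite weight_rcons (exprzDr t_unit) mulrC.
Qed.

Lemma weight1 m : weight [:: m] =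
  (m == 1 %[mod 3])%N%:Z - (m == 2 %[mod 3])%N%:Z.
Proof. by rewrite /weight /nu /= !addn0. Qed.

Lemma C_step0 m : (0 < m)%N -> (3 %| m)%N ->
  C m = C m.+1 + fpsX ^+ m * C (m + 3).
Proof.
move=> m0 m3; rewrite !C_gap_gf.
rewrite (gap_gf_last (p1 := leq m.+1) (p2 := leq (m + 3)) m0) //; last 2 first.
- by move=> a; rewrite leq_eqVlt eq_sym.
- by move=> a; rewrite /gap_rel; lia.
have [m1 m2] : (m == 1 %[mod 3])%N = false /\ (m == 2 %[mod 3])%N = false by lia.
rewrite weight1 m1 m2.
by rewrite subr0 expr0z fpsC1 mul1r.
Qed.

Lemma C_step1 m : (m == 1 %[mod 3])%N ->
  C m = C m.+1 + fpsC t * (fpsX ^+ m * C (m + 4)).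
Proof.
move=> m1; rewrite !C_gap_gf.
rewrite (gap_gf_last (p1 := leq m.+1) (p2 := leq (m + 4)) (m := m)) //;
  last 3 first.
- lia.
- by move=> a; rewrite leq_eqVlt eq_sym.
- by move=> a; rewrite /gap_rel; lia.
rewrite weight1 m1; have -> : (m == 2 %[mod 3])%N = false by lia.
by rewrite subr0 expr1z.
Qed.

(** Above [m] come m + 2, where the sum is divisible by 3, or parts from m + 4 on. A part m + 2 in
    turn forces the others up to m + 6, and the powers of t of the pair cancel. *)
Lemma C_step2 m : (m == 2 %[mod 3])%N ->
  C m = C m.+1 + fpsC (t ^ (- 1)) *
    (fpsX ^+ m * (C (m + 4) + fpsC t * (fpsX ^+ (m + 2) * C (m + 6)))).
Proof.
move=> m2; rewrite !C_gap_gf.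
pose p a := (a == m + 2)%N || (m + 4 <= a)%N.
have -> : gap_gf (leq m) = gap_gf (leq m.+1) +
    fpsC (t ^ weight [:: m]) * (fpsX ^+ m * gap_gf p).
  apply: gap_gf_last => [|a||a]; first lia.
  - by rewrite leq_eqVlt eq_sym.
  - by [].
  - by rewrite /p /gap_rel; lia.
have -> : gap_gf p = gap_gf (leq (m + 4)) +
    fpsC (t ^ weight [:: m + 2]%N) * (fpsX ^+ (m + 2) * gap_gf (leq (m + 6))).
  apply: gap_gf_last => [|a|a|a]; first lia.
  - by [].
  - by lia.
  - by rewrite /gap_rel; lia.
rewrite !weight1 m2.
have -> : (m == 1 %[mod 3])%N = false by lia.
have -> : (m + 2 == 1 %[mod 3])%N by lia.
have -> : (m + 2 == 2 %[mod 3])%N = false by lia.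
by rewrite subr0 sub0r expr1z.
Qed.

Lemma C_const m N : (N < m)%N -> C m N = (N == 0%N)%:R.
Proof.
move=> Nm; rewrite C_gap_gf /=; have [->|N0] := eqVneq N 0%N.
  have -> : gap_set (leq m) 0 = [set [::]]%classic.
    apply/seteqP; split=> l /=; last by move=> ->; split.
    case=> _ l0 _; case: l l0 => //= a l; rewrite inE; lia.
  by rewrite fsbig_set1.
rewrite fsbig1 // => l [_ _ al sl].
case: l al sl => [|a l] /=; first by move: N0; lia.
by case/andP=> ma _; lia.
Qed.

End GapPartitions.

(** * The gauge symmetry *)

(* lia compares the atoms f k a b syntactically, so their arguments have to be
   made identical first. *)
Ltac align f :=
  repeat match goal with |- context [f ?k ?a ?b] =>
    match goal with |- context [f k ?a' ?b'] =>
      assert_fails (constr_eq (f k a b) (f k a' b'));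
      let e := fresh in
      assert (e : f k a' b' = f k a b) by (congr (f k _ _); lia);
      rewrite {}e
    end
  end.

(** Outer induction on [mu], and for fixed (n, N) a descent in k from the index K at which [P]
    becomes known. *)
Lemma descending_ind (mu : int -> int -> int) (P : nat -> int -> int -> Prop) k0 :
  (forall k n N, mu n N < 0 -> P k n N) ->
  (forall n N, exists K, forall k, (K <= k)%N -> P k n N) ->
  (forall k n N, (k0 <= k)%N -> P k.+1 n N ->
     (forall k' n' N', (k0 <= k')%N -> mu n' N' < mu n N -> P k' n' N') ->
     P k n N) ->
  forall k n N, (k0 <= k)%N -> P k n N.
Proof.
move=> P_neg P_lim P_step.
suff IH m : forall k n N, (k0 <= k)%N -> mu n N < m%:Z -> P k n N.
  by move=> k n N k0k; apply: (IH `|mu n N|.+1) => //; lia.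
elim: m => [|m IHm] k n N k0k mu_lt; first exact: P_neg.
have [K PK] := P_lim n N.
have [/PK//|/ltnW kK] := leqP K k.
have: (k0 <= K - (K - k))%N by rewrite subKn.
rewrite -{2}(subKn kK); have := leq_subr k K; move: (K - k)%N => j {k k0k kK}.
elim: j => [|j IHj] jK k0j; first by apply: PK; rewrite subn0.
apply: P_step => // [|k' n' N' k0k' lt_mu]; last by apply: IHm => //; lia.
have -> : (K - j.+1).+1 = (K - j)%N by lia.
by apply: IHj; lia.
Qed.

(* The failure of the two gauge relations; precomposition with
   (n, N) |-> (n, N - 3 n) is the substitution t -> t q^3. *)
Definition shift_defect (al ga : nat -> int -> int -> int) k (n N : int) :=
  ga k n N - al k n (N - 3 * n) - ga k.+1 (n - 1) (N - 3 * k%:Z - 1 - 3 * n).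
Definition twist_defect (al ga : nat -> int -> int -> int) k (n N : int) :=
  al k n N + ga k.+1 (n - 1) (N - 1) - ga k.+1 n N - al k (n - 1) (N + 2 - 3 * n).

Section Recurrences.
(** These abstract the coefficients of a_k and c_k; the stability hypotheses express a_k, c_k ->
    1. *)
Variables al ga : nat -> int -> int -> int.
Hypothesis alE : forall k n N, al k n N =
  ga k.+1 n N + ga k.+2 (n - 1) (N - 3 * k%:Z - 4) + al k.+1 n (N - 3 * k%:Z - 3).
Hypothesis gaE : forall k n N, ga k n N =
  al k n N + al k.+1 (n + 1) (N - 3 * k%:Z - 2) + ga k.+2 n (N - 6 * k%:Z - 6).
Hypothesis al_stable : forall k n N, N <= k%:Z ->
  al k n N = ((n == 0) && (N == 0))%:Z.
Hypothesis ga_stable : forall k n N, N <= k%:Z ->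
  ga k n N = ((n == 0) && (N == 0))%:Z.

Let al_neg k n N : N < 0 -> al k n N = 0.
Proof. by move=> N0; rewrite al_stable ?(lt_eqF N0) ?andbF //; lia. Qed.
Let ga_neg k n N : N < 0 -> ga k n N = 0.
Proof. by move=> N0; rewrite ga_stable ?(lt_eqF N0) ?andbF //; lia. Qed.

Local Notation x := (shift_defect al ga).
Local Notation y := (twist_defect al ga).

(** Together with [yE] this is a homogeneous linear system for the defects, so convergence to 0 for
    large k will force them to vanish. *)
Let xE k n N : x k n N =
  x k.+1 n N + x k.+2 (n + 1) (N - 3 * k%:Z - 2) + x k.+2 n (N - 6 * k%:Z - 6)
  + y k.+1 (n + 1) (N - 3 * k%:Z - 2) + y k.+1 n (N - 3 * k%:Z - 3).
Proof.
rewrite /shift_defect /twist_defect.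
move: (alE k n N) (gaE k n N) (alE k n (N - 3 * n)) (gaE k.+1 n (N - 3 * n))
 (gaE k.+1 (n - 1) (N - 3 * k%:Z - 1 - 3 * n)).
align al; align ga.
lia.
Qed.

Let yE k n N : y k n N =
  x k.+1 (n - 1) (N - 1) + y k.+1 n (N - 3 * k%:Z - 3) + x k.+2 n (N - 3 * k%:Z - 3).
Proof.
rewrite /shift_defect /twist_defect.
move: (alE k n N) (alE k (n - 1) (N + 2 - 3 * n))
  (gaE k.+1 (n - 1) (N + 2 - 3 * n)).
align al; align ga.
lia.
Qed.

(* The twist defect is taken at N - 3: this makes N + 3 |n| decrease in all the
   terms of the recurrences other than x k.+1 n N. *)
Let xy0 k n N : (2 <= k)%N -> x k n N = 0 /\ y k n (N - 3) = 0.
Proof.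
apply: (descending_ind (mu := fun n N => N + 3 * `|n|)
  (P := fun k n N => x k n N = 0 /\ y k n (N - 3) = 0)) => {k n N}.
- move=> k n N mu_lt0; rewrite /shift_defect /twist_defect !al_neg ?ga_neg //; lia.
- move=> n N; exists (`|N| + 6 * `|n| + 5)%N => k kK /=.
  rewrite /shift_defect /twist_defect !al_stable ?ga_stable; lia.
- move=> k n N k2 [x1 _] IH.
  have IHx k' n' N' : (2 <= k')%N -> N' + 3 * `|n'| < N + 3 * `|n| ->
    x k' n' N' = 0.
    by move=> k'2 lt_mu; case: (IH k' n' N').
  have IHy k' n' N' : (2 <= k')%N -> N' + 3 + 3 * `|n'| < N + 3 * `|n| ->
    y k' n' N' = 0.
    by move=> k'2 lt_mu; case: (IH k' n' (N' + 3)) => // _; rewrite addrK.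
  rewrite (xE k) (yE k) x1 ![x k.+2 _ _]IHx ?[x k.+1 _ _]IHx ?IHy //; lia.
Qed.

(** The measure argument covers k >= 2; the recurrences carry the vanishing down to k = 1 and then k
    = 0. *)
Let defect0 : (forall k n N, x k n N = 0) * (forall k n N, y k n N = 0).
Proof.
have x2 j n N : x j.+2 n N = 0 by case: (@xy0 j.+2 n N).
have y2 j n N : y j.+2 n N = 0.
  by case: (@xy0 j.+2 n (N + 3)) => // _; rewrite addrK.
have x1 n N : x 1 n N = 0 by rewrite xE !x2 !y2.
have y1 n N : y 1 n N = 0 by rewrite yE !x2 !y2.
by split=> -[|[|k]] n N //; rewrite ?(xE 0%N) ?(yE 0%N) !x2 !x1 !y1.
Qed.

Let s n N := al 0 n N + ga 1 (n - 1) (N - 1).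

(** The functional equation of theta(t q^4; q^6), got by eliminating all but c_0 from the gauge
    relations at k = 0 and 1. *)
Let ga0_step n N : ga 0 n N = ga 0 (n - 1) (N - 6 * n + 2).
Proof.
move: (defect0.1 0%N n N) (defect0.1 1%N n (N - 3 * n))
  (defect0.2 0%N n (N - 3 * n)) (gaE 0 (n - 1) (N - 6 * n + 2)).
by rewrite /shift_defect /twist_defect; align al; align ga; lia.
Qed.

Lemma ga0_closed n N : ga 0 n N = ga 0 0 (N - 3 * n ^+ 2 - n).
Proof.
elim/int_rec: n N => [|n IHn|n IHn] N; first by congr ga; lia.
  by rewrite ga0_step intS addrAC subrr add0r IHn; congr ga; lia.
have := ga0_step (- n%:Z) (N - 6 * n%:Z - 2).
rewrite IHn => E.
transitivity (ga 0 (- n%:Z - 1) (N - 6 * n%:Z - 2 - 6 * (- n%:Z) + 2)).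
  by congr ga; lia.
by rewrite -E; congr ga; lia.
Qed.

Lemma s_closed n N : s n N = ga 0 0 (N - 3 * n ^+ 2 + 2 * n).
Proof.
transitivity (ga 0 n (N + 3 * n)); last by rewrite ga0_closed; congr ga; lia.
move: (defect0.1 0%N n (N + 3 * n)).
by rewrite /s /shift_defect /twist_defect; align al; align ga; lia.
Qed.

Lemma al0_step n N :
  al 0 n N = al 0 (n - 2) (N - 3 * n + 4) + s n N - s (n - 1) (N - 1).
Proof.
move: (defect0.2 0%N (n - 1) (N - 1)).
by rewrite /s /twist_defect; align al; align ga; lia.
Qed.

(** The bounds are the sizes of the partitions with |n| parts at distance 6, starting at the least
    admissible part congruent to 1 (n > 0) or 2 (n < 0) modulo 3. The factor 2 allows one formula
    for both signs. *)
Lemma ga_al_vanishing k n N :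
  (N < 3 * n ^+ 2 + n + 3 * k%:Z * `|n| -> ga k n N = 0) /\
  (2 * N < 6 * n ^+ 2 - n + (6 * k%:Z + 3) * `|n| -> al k n N = 0).
Proof.
pose P k n N :=
  (N < 3 * n ^+ 2 + n + 3 * k%:Z * `|n| -> ga k n N = 0) /\
  (2 * N < 6 * n ^+ 2 - n + (6 * k%:Z + 3) * `|n| -> al k n N = 0).
apply: (descending_ind (mu := fun _ N => N) (P := P) (k0 := 0)) => // {k n N}.
- by move=> k n N N0; split=> _; rewrite ?al_neg ?ga_neg.
- move=> n N; exists `|N|%N => k kN; split=> ltN.
    by rewrite ga_stable ?lez_abs2 //; case: (n =P 0) ltN => [->|//]; lia.
  by rewrite al_stable; case: (n =P 0) ltN => [->|//]; lia.
move=> k n N _ [ga1 _] IH.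
have IHg k' n' N' : N' < N -> N' < 3 * n' ^+ 2 + n' + 3 * k'%:Z * `|n'| ->
  ga k' n' N' = 0.
  by move=> ltN; apply: (IH k' n' N' _ ltN).1.
have IHa k' n' N' : N' < N ->
  2 * N' < 6 * n' ^+ 2 - n' + (6 * k'%:Z + 3) * `|n'| -> al k' n' N' = 0.
  by move=> ltN; apply: (IH k' n' N' _ ltN).2.
have al0 : 2 * N < 6 * n ^+ 2 - n + (6 * k%:Z + 3) * `|n| -> al k n N = 0.
  move=> ltN; rewrite alE ga1 ?IHg ?IHa //; nia.
split=> // ltN; rewrite gaE al0 ?IHg ?IHa //; nia.
Qed.

(* For n >= 0 the lowest terms of ga k n come from the partitions all of whose
   parts are congruent to 1 modulo 3. *)
Lemma ga_leading (p : nat -> int -> int) :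
  (forall m M, M < 0 -> p m M = 0) ->
  (forall M, p 0 M = (M == 0)%:Z) ->
  (forall m M, p m.+1 M = p m M + p m.+1 (M - 3 * m.+1%:Z)) ->
  forall k (m : nat) N,
  N - 3 * m%:Z ^+ 2 - m%:Z - 3 * k%:Z * m%:Z < 3 * k%:Z + 3 * m%:Z + 3 ->
  ga k m%:Z N = p m (N - 3 * m%:Z ^+ 2 - m%:Z - 3 * k%:Z * m%:Z).
Proof.
move=> p_neg p0 pS k m N.
pose P k n N := forall m : nat, m%:Z = n ->
  N - 3 * n ^+ 2 - n - 3 * k%:Z * n < 3 * k%:Z + 3 * n + 3 ->
  ga k n N = p m (N - 3 * n ^+ 2 - n - 3 * k%:Z * n).
suff: P k m%:Z N by exact.
apply: (descending_ind (mu := fun _ N => N) (P := P) (k0 := 0)) => // {k m N}.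
- by move=> k n N N0 m em ltN; rewrite ga_neg // p_neg //; nia.
- move=> n N; exists (`|N|.+1)%N => k kN m em ltN; rewrite ga_stable; last by lia.
  case: m em ltN => [|m] <- ltN; first by rewrite p0; congr (nat_of_bool _)%:Z; lia.
  by rewrite p_neg //; nia.
move=> k n N _ ga1 IH m em ltN.
(* In the given range only [ga k.+1 n] and [ga k.+2 (n - 1)] survive; they match the two terms of
   [pS]. *)
rewrite gaE alE (ga_al_vanishing k.+1 n _).2 ?(ga_al_vanishing k.+1 (n + 1) _).2
  ?(ga_al_vanishing k.+2 n _).1; try nia.
rewrite !addr0 (ga1 m em); last by nia.
case: m em => [|m] em.
  rewrite ga_neg ?addr0; last by nia.
  by congr p; nia.
rewrite (IH k.+2 (n - 1) _ _ _ m); try nia.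
by rewrite [RHS]pS addrC; congr (p _ _ + p _ _); nia.
Qed.

End Recurrences.

(** * The coefficients of the generating functions *)

Section Coefficients.

Let al k n N := tq_coef (C (3 * k + 3)) n N.
Let ga k n N := tq_coef (C (3 * k + 2)) n N.

Lemma C_mul3_rec k n N : al k n N =
  ga k.+1 n N + ga k.+2 (n - 1) (N - 3 * k%:Z - 4) + al k.+1 n (N - 3 * k%:Z - 3).
Proof.
have tE : fpsC t = fpsC (t ^ 1) by rewrite expr1z.
rewrite /al /ga (@C_step0 (3 * k + 3)) ?(@C_step1 (3 * k + 3).+1) ?tE; try lia.
rewrite !(tq_coefD, tq_coef_texpM, tq_coef_XnM).
have -> : (3 * k + 3).+2 = (3 * k.+1 + 2)%N by lia.
have -> : ((3 * k + 3).+1 + 4 = 3 * k.+2 + 2)%N by lia.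
have -> : (3 * k + 3 + 3 = 3 * k.+1 + 3)%N by lia.
have -> : N - (3 * k + 3).+1%:Z = N - 3 * k%:Z - 4 by lia.
by have -> : N - (3 * k + 3)%N%:Z = N - 3 * k%:Z - 3 by lia.
Qed.

Lemma C_mod2_rec k n N : ga k n N =
  al k n N + al k.+1 (n + 1) (N - 3 * k%:Z - 2) + ga k.+2 n (N - 6 * k%:Z - 6).
Proof.
have tE : fpsC t = fpsC (t ^ 1) by rewrite expr1z.
rewrite /al /ga (@C_step2 (3 * k + 2)) ?tE; last by lia.
rewrite !(tq_coefD, tq_coef_texpM, tq_coef_XnM) addrA opprK addrK.
have -> : (3 * k + 2).+1 = (3 * k + 3)%N by lia.
have -> : (3 * k + 2 + 4 = 3 * k.+1 + 3)%N by lia.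
have -> : (3 * k + 2 + 6 = 3 * k.+2 + 2)%N by lia.
have -> : N - (3 * k + 2)%N%:Z - (3 * k + 2 + 2)%N%:Z = N - 6 * k%:Z - 6 by lia.
by have -> : N - (3 * k + 2)%N%:Z = N - 3 * k%:Z - 2 by lia.
Qed.

Lemma tq_coef_C_const m n N : N < m%:Z ->
  tq_coef (C m) n N = ((n == 0) && (N == 0))%:Z.
Proof.
case: N => N Nm /=; last by rewrite andbF.
rewrite -[LHS]/((C m N)@_n) C_const //; case: N {Nm} => [|N];
  last by rewrite mcoeff0 andbF.
by rewrite -[1%:R]/(lmono 1 0) coef_lmono andbT eq_sym; case: eqP.
Qed.

Lemma C_mul3_stable k n N : N <= k%:Z -> al k n N = ((n == 0) && (N == 0))%:Z.
Proof. by move=> Nk; rewrite /al tq_coef_C_const //; lia. Qed.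

Lemma C_mod2_stable k n N : N <= k%:Z -> ga k n N = ((n == 0) && (N == 0))%:Z.
Proof. by move=> Nk; rewrite /ga tq_coef_C_const //; lia. Qed.

(** The coefficients of the factor K, read off as the part of C_2 free of t. *)
Definition kappa (N : int) : int := tq_coef (C 2) 0 N.

Lemma kappa_neg N : N < 0 -> kappa N = 0.
Proof. by case: N. Qed.

Lemma tq_coef_C2 n N : tq_coef (C 2) n N = kappa (N - 3 * n ^+ 2 - n).
Proof. exact: (ga0_closed C_mul3_rec C_mod2_rec C_mul3_stable C_mod2_stable). Qed.

Lemma tq_coef_C2starE n N : tq_coef C2star n N = al 0 n N + ga 1 (n - 1) (N - 1).
Proof.
have tE : fpsC t = fpsC (t ^ 1) by rewrite expr1z.
rewrite /C2star (@C_step1 1) // tE !(tq_coefD, tq_coefN).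
rewrite tq_coef_texpM tq_coef_XnM [_ + _ - _]addrAC subrr add0r addrC.
by [].
Qed.

Lemma tq_coef_C2star n N : tq_coef C2star n N = kappa (N - 3 * n ^+ 2 + 2 * n).
Proof.
rewrite tq_coef_C2starE.
exact: (s_closed C_mul3_rec C_mod2_rec C_mul3_stable C_mod2_stable).
Qed.

Lemma tq_coef_C3_step n N : tq_coef (C 3) n N =
  tq_coef (C 3) (n - 2) (N - 3 * n + 4)
  + kappa (N - 3 * n ^+ 2 + 2 * n) - kappa (N - 3 * n ^+ 2 + 8 * n - 6).
Proof.
have -> : tq_coef (C 3) =2 al 0 by [].
rewrite (al0_step C_mul3_rec C_mod2_rec C_mul3_stable C_mod2_stable)
  -!tq_coef_C2starE !tq_coef_C2star.
by congr (_ + _ - kappa _); lia.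
Qed.

Lemma tq_coef_C3_vanish n N : 2 * N < 6 * n ^+ 2 - n + 3 * `|n| ->
  tq_coef (C 3) n N = 0.
Proof.
by move=> ltN; apply: (ga_al_vanishing C_mul3_rec C_mod2_rec C_mul3_stable
  C_mod2_stable 0 n N).2; lia.
Qed.

Definition geo d : fps laurent := Fps (fun N => (d %| N)%:R).

Lemma geoE d : (0 < d)%N -> (1 - fpsX ^+ d) * geo d = 1.
Proof.
move=> d0; apply/fpsP => N; rewrite mulrBl mul1r -[LHS]/(geo d N - _ N)
  coef_fpsXnM /=.
case: leqP => dN.
  by rewrite -{1}(subnK dN) dvdn_addl // subrr; case: N dN => //; lia.
case: N dN => [|N] dN; first by rewrite dvdn0 subr0.
by rewrite gtnNdvd // subr0.
Qed.

Definition recip_poch m : fps laurent := \prod_(j < m) geo (3 * j.+1).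

Lemma recip_pochE m : qpoch (fpsX ^+ 3) (fpsX ^+ 3) m * recip_poch m = 1.
Proof.
rewrite -big_split big1 // => j _ /=.
by rewrite -exprS -exprM geoE.
Qed.

(** Freedom from t: such a series is determined by its coefficients at t^0. *)
Definition integer_series (h : fps laurent) :=
  forall N, exists z : int, h N = z%:~R.

Lemma recip_poch_int m : integer_series (recip_poch m).
Proof.
apply: (big_ind integer_series) => [N|f g fi gi N|j _ N].
- by exists (N == 0%N)%:R; case: N.
- rewrite coef_fpsM.
  apply: (big_ind (fun x => exists z : int,
    x = z%:~R)) => [|_ _ [z ->] [z' ->]|i _].
  + by exists 0.
  + by exists (z + z'); rewrite intrD.
  + by have [z ->] := fi i; have [z' ->] := gi (N - i)%N; exists (z * z');
    rewrite intrM.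
by exists (3 * j.+1 %| N)%:R; rewrite /=; case: (3 * j.+1 %| N)%N.
Qed.

Lemma coef_intr (z : int) n : (z%:~R : laurent)@_n = z *+ (n == 0).
Proof.
have E : (1 : laurent)@_n = 1 *+ (n == 0) by rewrite eq_sym; apply: coef_lmono.
by rewrite raddfMz /= E; case: eqP; rewrite ?mulr1n ?mulr0n ?mul0rz ?intz.
Qed.

Definition kappa_series : fps laurent := Fps (fun N => (kappa N%:Z)%:~R).

Lemma tq_coef_kappa_series n N : tq_coef kappa_series n N = kappa N *+ (n == 0).
Proof.
case: N => N /=; first by rewrite coef_intr.
by rewrite mul0rn.
Qed.

Lemma kappa_series_eqmod m : fps_eqmod (3 * m + 3) kappa_series (recip_poch m).
Proof.
move=> N ltN; have [z zE] := recip_poch_int m N.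
rewrite /= zE; congr (_%:~R).
(* The shift of [N] by 3 m^2 + m cancels the theta exponent of C_2 at t^m, leaving [kappa]
   itself. *)
have := ga_leading C_mul3_rec C_mod2_rec C_mul3_stable C_mod2_stable 
  (p := fun m => tq_coef (recip_poch m) 0) _ _ _ (k := 0) (m := m) (N := N%:Z + 3 * m%:Z ^+ 2 + m%:Z).
rewrite -[ga 0 m _]/(tq_coef (C 2) _ _) tq_coef_C2.
have -> : N%:Z + 3 * m%:Z ^+ 2 + m%:Z - 3 * m%:Z ^+ 2 - m%:Z = N%:Z by lia.
rewrite mulr0 mul0r subr0 /= zE coef_intr; apply.
- by move=> m' [].
- move=> [[|M]|] //; rewrite /recip_poch big_ord0; last exact: mcoeff0.
  exact: (coef_lmono 1 0 0).
- move=> m' M; rewrite -tq_coef_XnM; rewrite -tq_coefD; congr tq_coef.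
  rewrite {1 3}/recip_poch big_ord_recr /= -/(recip_poch m').
  by rewrite -[X in _ = X + _](mulr1) -(@geoE (3 * m'.+1)) //; ring.
- lia.
Qed.

Lemma kappa_seriesE : qpoch_inf (fpsX ^+ 3) (fpsX ^+ 3) * kappa_series = 1.
Proof.
apply: fps_eqmodP => N; rewrite -(recip_pochE N).
apply: fps_eqmodM; first exact: qpoch_infE.
by apply: (fps_eqmodW _ (@kappa_series_eqmod N)); lia.
Qed.

End Coefficients.

(** * Finitely supported sums over the integers *)

Section BilateralSums.
Variable V : zmodType.
Implicit Types F : int -> V.

Lemma bilateral_sum_seq F (r : seq int) : uniq r ->
  (forall k, k \notin r -> F k = 0) ->
  \sum_(k \in [set: int]) F k = \sum_(k <- r) F k.
Proof.
move=> r_uniq F0; rewrite (fsbigE r) //; last by move=> k _; apply: F0.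
by apply: eq_bigl => k; rewrite in_setT.
Qed.

Lemma bilateral_sum_window F M : (forall k, (M < `|k|)%N -> F k = 0) ->
  \sum_(k \in [set: int]) F k = \sum_(i < (M + M).+1) F (i%:Z - M%:Z).
Proof.
move=> F0.
rewrite (@bilateral_sum_seq _ [seq i%:Z - M%:Z | i <- iota 0 (M + M).+1]).
- by rewrite big_map -(big_mkord xpredT (fun i => F (i%:Z - M%:Z))) /index_iota
  subn0.
- by rewrite map_inj_uniq ?iota_uniq // => i j /= E; lia.
- move=> k kr; apply: F0; rewrite ltnNge; apply: contra kr => kM.
  by apply/mapP; exists (absz (k + M%:Z)); rewrite ?mem_iota; lia.
Qed.

Lemma bilateral_sum_halves F L :
  (forall k, (L%:Z <= k) || (k < - L%:Z) -> F k = 0) ->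
  \sum_(k \in [set: int]) F k = \sum_(i < L) (F i%:Z + F (- i%:Z - 1)).
Proof.
move=> F0; rewrite (@bilateral_sum_seq _
  ([seq i%:Z | i <- iota 0 L] ++ [seq - i%:Z - 1 | i <- iota 0 L])).
- rewrite big_cat !big_map big_split; congr (_ + _).
    by rewrite -(big_mkord xpredT (fun i => F i%:Z)) /index_iota subn0.
  by rewrite -(big_mkord xpredT (fun i => F (- i%:Z - 1))) /index_iota subn0.
- rewrite cat_uniq !map_inj_uniq ?iota_uniq ?andbT /=; try by move=> i j /= E; lia.
  by apply/hasPn => _ /mapP[i _ ->]; apply/mapP => -[j _]; lia.
- move=> k; rewrite mem_cat negb_or => /andP[kp kn]; apply: F0.
  apply: contraNT kp; rewrite negb_or => kL.
  have [k0|k0] := leP 0 k; first by apply/mapP; exists (absz k);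
    rewrite ?mem_iota; lia.
  case/negP: kn; apply/mapP; exists (absz (k + 1)); rewrite ?mem_iota; lia.
Qed.

Lemma bilateral_sum_reindex F (h g : int -> int) : cancel h g -> cancel g h ->
  \sum_(k \in [set: int]) F k = \sum_(k \in [set: int]) F (h k).
Proof. by move=> hK gK; apply: reindex_fsbigT; exists g. Qed.

(** The split is by the parity of k + m, with the odd class traversed in reverse. *)
Lemma bilateral_sum_parity F L m : (forall k, (L < `|k|)%N -> F k = 0) ->
  \sum_(k \in [set: int]) F k =
  \sum_(i \in [set: int]) F (2 * i + m)
  + \sum_(i \in [set: int]) F (- (2 * i + 1 + m)).
Proof.
move=> F0.
rewrite (@bilateral_sum_reindex F (fun k => k + m) (fun k => k - m));
  try by move=> k; lia.
rewrite (@bilateral_sum_reindex (fun i => F (- (2 * i + 1 + m))) (fun k => k - m)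
  (fun k => k + m));
  try by move=> k; lia.
pose L' := (L + absz m + absz m + 2)%N.
rewrite (@bilateral_sum_halves _ (L' + L')); last by move=> k kL; apply: F0;
  rewrite /L' in kL; lia.
rewrite (@bilateral_sum_halves _ L'); last by move=> k kL; apply: F0;
  rewrite /L' in kL; lia.
rewrite (@bilateral_sum_halves _ L'); last by move=> k kL; apply: F0;
  rewrite /L' in kL; lia.
rewrite -big_split /=; elim: L' => [|l IHl]; first by rewrite !big_ord0.
have -> : (l.+1 + l.+1 = (l + l).+2)%N by lia.
rewrite !big_ord_recr /= IHl -[LHS]addrA; congr (_ + _).
rewrite [X in _ + X = _]addrC addrACA.
by congr (F _ + F _ + (F _ + F _)); lia.
Qed.

End BilateralSums.

(** * The quintuple product identity in coefficient form *)

Section CapparelliProduct.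

Let sgn (k : int) : int := (- 1) ^ k.

Let sgnE (k : int) : ((-1) ^ k : laurent) = (sgn k)%:~R.
Proof. by rewrite /sgn rmorphXz //= rmorphN1. Qed.

Let sgn2 k : sgn (2 * k) = 1.
Proof. by rewrite /sgn -exprz_exp exp1rz. Qed.

Let sgnD k l : sgn (k + l) = sgn k * sgn l.
Proof. by rewrite /sgn exprzDr. Qed.

Lemma tq_coef_theta c (a b : nat) M h n N :
  c \is a GRing.unit -> (0 < a < b)%N -> N < M%:Z ->
  tq_coef (theta c a b * h) n N = \sum_(i < (M + M).+1)
    tq_coef (fpsC (c ^ (i%:Z - M%:Z)) *
      (fpsX ^+ theta_exp a b (i%:Z - M%:Z) * h)) n N.
Proof.
move=> cu ab NM.
have E := fps_eqmodM (theta_eqmod cu ab (N := M)) (@fps_eqmod_refl _ _ h).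
rewrite (tq_coef_eqmod _ E) //.
by rewrite mulr_suml tq_coef_sum; apply: eq_bigr => i _; rewrite mulrA.
Qed.

Definition capparelli_product : fps laurent :=
  qpoch_inf (- fpsX ^+ 3) (fpsX ^+ 3) * theta (- t ^+ 2) 2 6.

(** (-q^3; q^3)_oo is (q^6; q^6)_oo / (q^3; q^3)_oo: the numerator is a pentagonal theta function
    and the reciprocal is K. *)
Lemma capparelli_productE :
  capparelli_product = theta (- t ^+ 2) 2 6 * (theta (- 1) 12 18 * kappa_series).
Proof.
rewrite /capparelli_product mulrC; congr (_ * _).
rewrite -[LHS]mulr1 -kappa_seriesE mulrA qpoch_infNM //.
by rewrite -(@theta_pentagonal _ 6).
Qed.

Let t2_unit : - t ^+ 2 \is a GRing.unit.
Proof. by rewrite unitrN unitrX ?t_unit. Qed.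

Let inner n N : tq_coef (theta (- 1) 12 18 * kappa_series) n N =
  (\sum_(l \in [set: int]) sgn l * kappa (N - 9 * l ^+ 2 - 3 * l)) *+ (n == 0).
Proof.
pose M := (absz N).+1.
rewrite (@tq_coef_theta _ _ _ M) ?unitrN1 //; last by rewrite /M; lia.
rewrite (@bilateral_sum_window _ _ M); last first.
  by move=> l lM; rewrite kappa_neg ?mulr0 //; rewrite /M in lM; nia.
rewrite -sumrMnl; apply: eq_bigr => i _.
rewrite sgnE tq_coef_intM tq_coef_XnM tq_coef_kappa_series mulrnAr;
  congr (_ * kappa _ *+ _).
by have := @theta_expE 12 18 (i%:Z - M%:Z) isT; lia.
Qed.

Let product_sum M n N : N < M%:Z -> tq_coef capparelli_product n N =
  \sum_(i < (M + M).+1) sgn (i%:Z - M%:Z) *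
     tq_coef (theta (- 1) 12 18 * kappa_series) (n - 2 * (i%:Z - M%:Z))
       (N - 3 * (i%:Z - M%:Z) ^+ 2 + (i%:Z - M%:Z)).
Proof.
move=> NM; rewrite capparelli_productE (@tq_coef_theta _ _ _ M) //.
apply: eq_bigr => i _; rewrite expNrz -[t ^+ 2]/(t ^ 2%:Z) exprz_exp.
rewrite sgnE fpsCM -mulrA tq_coef_intM tq_coef_texpM tq_coef_XnM.
congr (_ * tq_coef _ _ _).
by have := @theta_expE 2 6 (i%:Z - M%:Z) isT; lia.
Qed.

Lemma capparelli_product_odd (m N : int) :
  tq_coef capparelli_product (2 * m + 1) N = 0.
Proof.
rewrite (@product_sum (absz N).+1); last by lia.
rewrite big1 // => i _; rewrite inner.
by case: eqP => [E|_]; [lia | rewrite mulr0].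
Qed.

Lemma capparelli_product_even (m N : int) : tq_coef capparelli_product (2 * m) N =
  \sum_(l \in [set: int])
    sgn (l + m) * kappa (N - 3 * m ^+ 2 + m - 9 * l ^+ 2 - 3 * l).
Proof.
pose M := (absz N + absz m + 1)%N.
have mM : (absz (m + M%:Z)%R < (M + M).+1)%N by rewrite /M; lia.
rewrite (@product_sum M); last by rewrite /M; lia.
(* The inner series is free of t, so only the theta index [m] yields t^(2m). *)
rewrite (bigD1 (Ordinal mM)) //= big1 ?addr0 => [|i im]; last first.
  rewrite inner; case: eqP => [E|_]; last by rewrite mulr0.
  by case/eqP: im; apply: val_inj => /=; lia.
have -> : (absz (m + M%:Z))%:Z - M%:Z = m by rewrite /M; lia.
rewrite inner subrr mulr1n.
pose L := (absz N + absz m + 5 + absz m * absz m * 3)%N.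
have F0 l : (L < absz l)%N -> kappa (N - 3 * m ^+ 2 + m - 9 * l ^+ 2 - 3 * l) = 0.
  by move=> lL; rewrite kappa_neg //; nia.
rewrite !(@bilateral_sum_window _ _ L); try by move=> l /F0 ->; rewrite mulr0.
by rewrite mulr_sumr; apply: eq_bigr => i _; rewrite mulrA [sgn m * _]mulrC -sgnD.
Qed.

Lemma chi3_mod3 i :
  (chi3 (3 * i) = 1) * (chi3 (3 * i).+1 = -1) * (chi3 (3 * i).+2 = 0).
Proof.
split; first split; rewrite /chi3 /legendre.
- rewrite ifF; last by lia.
  case: existsP => // -[]; exists (Ordinal (isT : (1 < 3)%N)).
  by rewrite /= exp1n; lia.
- rewrite ifF; last by lia.
  case: existsP => // -[[[|[|[|x]]] //= ltx]]; move/eqP; lia.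
- by rewrite ifT //; lia.
Qed.

Lemma sum_chi3 (f : nat -> int) L :
  \sum_(k < 3 * L) chi3 k * f k = \sum_(i < L) (f (3 * i)%N - f (3 * i).+1).
Proof.
elim: L => [|L IHL]; first by rewrite !big_ord0.
have -> : (3 * L.+1 = (3 * L).+3)%N by lia.
by rewrite !big_ord_recr /= IHL !chi3_mod3 mul1r mulN1r mul0r addr0 addrA.
Qed.

(* The coefficient of t^n q^N in C 2 * (t^-k q^(k(k+1))) is
   kappa (N - theta1_exp n k), and in C2star * (t^k q^(k^2)) it is
   kappa (N - theta2_exp n k). *)
Definition theta1_exp (n k : int) : int :=
  k ^+ 2 + k + 3 * (n + k) ^+ 2 + (n + k).
Definition theta2_exp (n k : int) : int :=
  k ^+ 2 + 3 * (n - k) ^+ 2 - 2 * (n - k).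

Lemma theta1_exp_ge (n k : int) : k ^+ 2 + k <= theta1_exp n k.
Proof. by rewrite /theta1_exp; nia. Qed.

Lemma theta2_exp_ge (n k : int) : k ^+ 2 <= theta2_exp n k.
Proof. by rewrite /theta2_exp; nia. Qed.

(** This reflection turns the negative half of the bilateral Theta_1, times C_2, into t^2 q^2
    sigma(C_2^* Theta_2) up to sign. *)
Lemma theta1_exp_reflect (n k : int) :
  theta1_exp n (- k - 2) = theta2_exp (n - 2) k + 3 * n - 4.
Proof. by rewrite /theta1_exp /theta2_exp; ring. Qed.

(** The right-hand side is C_2 times the bilateral Theta_1, split into indices k and -k - 2 with k
    >= 0; the character is odd under this reflection. *)
Lemma capparelli_quintuple L (n N : int) : (absz N + 2 <= L)%N ->
  tq_coef capparelli_product n N =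
  \sum_(i < L) (kappa (N - theta1_exp n (3 * i%:Z))
                - kappa (N - theta1_exp n (3 * i%:Z + 1)))
  - \sum_(i < L) (kappa (N - theta1_exp n (- (3 * i%:Z) - 2))
                  - kappa (N - theta1_exp n (- (3 * i%:Z + 1) - 2))).
Proof.
move=> NL.
(* For odd n the two bilateral sums agree; for n = 2m they are the terms of even
   and of odd index l + m in the pentagonal series. *)
pose A (i : int) := kappa (N - theta1_exp n (3 * i)).
pose B (i : int) := kappa (N - theta1_exp n (3 * i + 1)).
have sqr_ge (i : int) : (L%:Z <= i) || (i < - L%:Z) ->
  2 * `|i| <= i * i by move=> iL; nia.
have A0 (i : int) : (L%:Z <= i) || (i < - L%:Z) -> A i = 0.
  by move=> iL; rewrite /A kappa_neg //; have := theta1_exp_ge n (3 * i);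
    have := sqr_ge i iL; lia.
have B0 (i : int) : (L%:Z <= i) || (i < - L%:Z) -> B i = 0.
  by move=> iL; rewrite /B kappa_neg //; have := theta1_exp_ge n (3 * i + 1);
    have := sqr_ge i iL; lia.
transitivity (\sum_(i \in [set: int]) A i - \sum_(i \in [set: int]) B i);
  last first.
  rewrite (bilateral_sum_halves A0) (bilateral_sum_halves B0) -!sumrB.
  apply: eq_bigr => i _; rewrite /A /B.
  have -> : - (3 * i%:Z) - 2 = 3 * (- i%:Z - 1) + 1 by lia.
  have -> : - (3 * i%:Z + 1) - 2 = 3 * (- i%:Z - 1) by lia.
  by ring.
have [m [en|en]] : exists m, n = 2 * m + 1 \/ n = 2 * m.
  by exists (divz n 2); lia.
  rewrite en capparelli_product_odd; apply/esym/eqP; rewrite subr_eq0; apply/eqP.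
  (* For n = 2m + 1 the quadratic [theta1_exp n] is invariant under k -> -3m - 2 - k, which
     exchanges the classes 0 and 1 modulo 3. *)
  rewrite (@bilateral_sum_reindex _ A (fun i => - (m + 1) - i)
    (fun i => - (m + 1) - i)); try by move=> i; lia.
  by apply: eq_fsbigr => i _; rewrite /A /B; congr (kappa (N - _));
    rewrite /theta1_exp en; ring.
rewrite {1}en capparelli_product_even.
pose F l := sgn (l + m) * kappa (N - 3 * m ^+ 2 + m - 9 * l ^+ 2 - 3 * l).
rewrite (@bilateral_sum_parity _ F (absz N + absz m + 5 + absz m * absz m * 3)
  m); last first.
  by move=> l lL; rewrite /F kappa_neg ?mulr0 //; nia.
congr (_ + _).
  apply: eq_fsbigr => i _; rewrite /F (_ : 2 * i + m + m = 2 * (i + m));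
    last by ring.
  rewrite sgn2 mul1r.
  by rewrite /A; congr (kappa _); rewrite /theta1_exp en; ring.
have FB i : F (- (2 * i + 1 + m)) = - B i.
  rewrite /F /B (_ : - _ + m = 2 * (- i - 1) + 1); last by ring.
  rewrite sgnD sgn2 mul1r /sgn expr1z mulN1r.
  by congr (- kappa _); rewrite /theta1_exp en; ring.
rewrite (eq_fsbigr (fun i => - B i)); last by move=> i _; apply: FB.
rewrite (bilateral_sum_halves B0) (@bilateral_sum_halves _ _ L) -?sumrN.
  by apply: eq_bigr => i _; rewrite opprD.
by move=> i /B0 ->; rewrite oppr0.
Qed.

End CapparelliProduct.

(** Each coefficient of the partial sums is eventually constant, so the limit does not take its
    default value. *)
Lemma fps_sum_eqmod (R : comNzRingType) (F : nat -> fps R) N :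
  (forall k, fps_eqmod k (F k) 0) ->
  fps_eqmod N (fps_sum F) (\sum_(k < N) F k).
Proof.
move=> F0.
have stable M m : (M <= m)%N -> fps_eqmod M (\sum_(k < m) F k) (\sum_(k < M) F k).
  elim: m => [|m IHm]; first by rewrite leqn0 => /eqP ->.
  rewrite leq_eqVlt => /predU1P[-> //|Mm];
    rewrite big_ord_recr /= -[X in fps_eqmod _ _ X]addr0.
  by apply: fps_eqmodD; [exact: IHm | apply: fps_eqmodW (F0 m)].
rewrite /fps_sum (@fps_limE _ _ (Fps (fun n => (\sum_(k < n.+1) F k) n))).
  by move=> n nN; rewrite (stable _ _ nN).
by move=> n; exists n.+1 => m nm /=; apply: (stable _ _ nm).
Qed.

(** * The equation for C_3 and its unique decaying solution *)

Section Assembly.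

(** The coefficient of C_2^* Theta_2, exact once N < M. *)
Let U M (n N : int) : int := \sum_(k < M) chi3 k * kappa (N - theta2_exp n k%:Z).

Let U_stable M M' (n N : int) : N < M%:Z -> (M <= M')%N -> U M' n N = U M n N.
Proof.
move=> NM; elim: M' => [|M' IH]; first by rewrite leqn0 => /eqP ->.
rewrite leq_eqVlt => /predU1P[-> //|MM']; rewrite {1}/U big_ord_recr /= -/(U _ _ _).
by rewrite IH // kappa_neg ?mulr0 ?addr0 //; have := theta2_exp_ge n M'; nia.
Qed.

(** Write tau for t^2 q^2 sigma, that is (n, N) -> (n - 2, N - 3 n + 4). Dropping the first period
    of [chi3] amounts to applying tau twice. *)
Let U_step M (n N : int) : U M.+3 n N =
  kappa (N - 3 * n ^+ 2 + 2 * n) - kappa (N - 3 * n ^+ 2 + 8 * n - 6)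
  + U M (n - 4) (N - 6 * n + 14).
Proof.
have bump0 k : bump 0 k = k.+1 by [].
rewrite /U !big_ord_recl /= !bump0.
have chi3_add k : chi3 k.+3 = chi3 k.
  have := divn_eq k 3; have := ltn_pmod k (isT : (0 < 3)%N).
  move: (k %/ 3)%N (k %% 3)%N => i [|[|[|//]]] _ ->;
    rewrite mulnC ?addn0 ?addn1 ?addn2.
  - by rewrite !chi3_mod3 (_ : (3 * i).+3 = 3 * i.+1)%N ?chi3_mod3 //; lia.
  - by rewrite !chi3_mod3 (_ : (3 * i).+4 = (3 * i.+1).+1)%N ?chi3_mod3 //; lia.
  - by rewrite !chi3_mod3 (_ : (3 * i).+1.+4 = (3 * i.+1).+2)%N ?chi3_mod3 //; lia.
rewrite (chi3_mod3 0).1.1 (chi3_mod3 0).1.2 (chi3_mod3 0).2 mul1r mulN1r mul0r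
  add0r addrA.
congr (kappa _ - kappa _ + _); try by rewrite /theta2_exp; ring.
apply: eq_bigr => i _; rewrite !bump0 chi3_add; congr (_ * kappa _).
by rewrite /theta2_exp; lia.
Qed.

(** In terms of [U] this is (1 + tau) U, the form that the right-hand side for C_3 takes after the
    quintuple product identity. *)
Let F (n N : int) : int :=
  U (absz N).+1 n N + U (absz (N - 3 * n + 4)).+1 (n - 2) (N - 3 * n + 4).

Let FE M (n N : int) : N < M%:Z -> N - 3 * n + 4 < M%:Z ->
  F n N = U M n N + U M (n - 2) (N - 3 * n + 4).
Proof.
move=> NM NM'; pose L := (M + (absz N).+1 + (absz (N - 3 * n + 4)%R).+1)%N.
rewrite /F -(@U_stable _ L)
  ?[U (absz (N - 3 * n + 4)).+1 _ _](esym (@U_stable _ L _ _ _ _));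
  try (rewrite /L; lia).
by congr (_ + _); apply: U_stable => //; rewrite /L; lia.
Qed.

(** F - tau F telescopes to U - tau^2 U, which [U_step] evaluates. *)
Let F_step (n N : int) : F n N = F (n - 2) (N - 3 * n + 4)
  + kappa (N - 3 * n ^+ 2 + 2 * n) - kappa (N - 3 * n ^+ 2 + 8 * n - 6).
Proof.
pose M := (absz N + 6 * absz n + 15)%N.
rewrite (@FE M.+3) ?(@FE M (n - 2)); try (rewrite /M; lia).
rewrite U_step (@U_stable M M.+3); try (rewrite /M; lia).
have -> : n - 2 - 2 = n - 4 by lia.
have -> : N - 3 * n + 4 - 3 * (n - 2) + 4 = N - 6 * n + 14 by lia.
by ring.
Qed.

Let F_vanish (n N : int) : n < 0 -> N < 3 * n ^+ 2 -> F n N = 0.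
Proof.
move=> n0 Nn; rewrite /F /U !big1 // => k _;
  rewrite kappa_neg ?mulr0 // /theta2_exp; nia.
Qed.

(* Iterating the recurrence j times turns (n, N) into (n - 2j, N + 3j^2 + O(j)),
   whereas both sides vanish at (n', N') as soon as N' < 3 n'^2 and n' < 0. *)
Let C3E (n N : int) : tq_coef (C 3) n N = F n N.
Proof.
pose d n N := tq_coef (C 3) n N - F n N.
have dE J : d n N = d (n - 2 * J%:Z) (N - 3 * n * J%:Z + 3 * J%:Z ^+ 2 + J%:Z).
  elim: J => [|J ->]; first by congr d; lia.
  rewrite /d tq_coef_C3_step F_step.
  transitivity (d (n - 2 * J%:Z - 2)
    (N - 3 * n * J%:Z + 3 * J%:Z ^+ 2 + J%:Z - 3 * (n - 2 * J%:Z) + 4)).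
    by rewrite /d; lia.
  by congr d; lia.
apply/eqP; rewrite -subr_eq0 -/(d n N) (dE (absz N + absz n + 1)%N) /d.
by rewrite tq_coef_C3_vanish ?F_vanish ?subr0 //; nia.
Qed.

Let Theta1E M (n N : int) : N < M%:Z -> tq_coef (C 2 * Theta1) n N =
  \sum_(k < M) chi3 k * kappa (N - theta1_exp n k%:Z).
Proof.
move=> NM.
have E : fps_eqmod M Theta1
    (\sum_(k < M) fpsC ((chi3 k)%:~R * t ^ (- k%:Z)) * q ^+ (k * (k + 1))).
  apply: fps_sum_eqmod => k n' nk; rewrite coef_fpsCM -[q ^+ _]mulr1 coef_fpsXnM
    ifN ?mulr0; first by case: n' nk.
  by rewrite -ltnNge; nia.
rewrite mulrC (tq_coef_eqmod _ (fps_eqmodM E (@fps_eqmod_refl _ _ _))) //.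
rewrite mulr_suml tq_coef_sum; apply: eq_bigr => k _.
rewrite fpsCM -!mulrA tq_coef_intM tq_coef_texpM tq_coef_XnM tq_coef_C2.
by congr (_ * kappa _); rewrite /theta1_exp; lia.
Qed.

Let Theta2E M (n N : int) : N < M%:Z -> tq_coef (C2star * Theta2) n N = U M n N.
Proof.
move=> NM.
have E : fps_eqmod M Theta2
    (\sum_(k < M) fpsC ((chi3 k)%:~R * t ^ k%:Z) * q ^+ (k ^ 2)).
  apply: fps_sum_eqmod => k n' nk; rewrite coef_fpsCM -[q ^+ _]mulr1 coef_fpsXnM
    ifN ?mulr0; first by case: n' nk.
  by rewrite -ltnNge; nia.
rewrite mulrC (tq_coef_eqmod _ (fps_eqmodM E (@fps_eqmod_refl _ _ _))) //.
rewrite mulr_suml tq_coef_sum; apply: eq_bigr => k _.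
rewrite fpsCM -!mulrA tq_coef_intM tq_coef_texpM tq_coef_XnM tq_coef_C2star.
by congr (_ * kappa _); rewrite /theta2_exp; lia.
Qed.

Lemma C3_identity : C 3 = - capparelli_product + C 2 * Theta1 + C2star * Theta2.
Proof.
apply: tq_coefP => n N.
(* Large enough that all truncations are exact at (n, N) and at its image under tau; 3 L terms make
   whole periods of [chi3]. *)
pose L := (absz N + 3 * absz n + 5)%N.
have lt1 : N < (3 * L)%N%:Z by rewrite /L; lia.
have lt2 : N - 3 * n + 4 < (3 * L)%N%:Z by rewrite /L; lia.
rewrite C3E (FE lt1 lt2).
transitivity (- tq_coef capparelli_product n N
    + \sum_(k < 3 * L) chi3 k * kappa (N - theta1_exp n k%:Z) + U (3 * L) n N);
      last first.
  by rewrite -(Theta1E n lt1) -(Theta2E n lt1) !tq_coefD tq_coefN.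
rewrite (@capparelli_quintuple L); last by rewrite /L; lia.
rewrite (sum_chi3 (fun k => kappa (N - theta1_exp n k%:Z))).
rewrite addrC; congr (_ + _).
(* The term tau U is the negative half of the quintuple sum, so the two positive halves cancel. *)
have -> : U (3 * L) (n - 2) (N - 3 * n + 4) =
    \sum_(i < L) (kappa (N - theta1_exp n (- (3 * i%:Z) - 2))
                  - kappa (N - theta1_exp n (- (3 * i%:Z + 1) - 2))).
  rewrite /U (sum_chi3 (fun k => kappa (N - 3 * n + 4 - theta2_exp (n - 2) k%:Z))).
  apply: eq_bigr => i _; rewrite !theta1_exp_reflect.
  have -> : (3 * i)%N%:Z = 3 * i%:Z by lia.
  have -> : (3 * i).+1%:Z = 3 * i%:Z + 1 by lia.
  by congr (kappa _ - kappa _); lia.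
rewrite opprB [X in _ = _ - _ + X](eq_bigr (fun i : 'I_L =>
  kappa (N - theta1_exp n (3 * i%:Z)) - kappa (N - theta1_exp n (3 * i%:Z + 1)))).
  by rewrite subrK.
by move=> i _; congr (kappa (N - theta1_exp n _) - kappa (N - theta1_exp n _)); lia.
Qed.

End Assembly.

Theorem theorem1p1 :
  C 1 = qpoch_inf (- q ^+ 3) (q ^+ 3) * theta (- t ^+ 2) 2 6
        + C 2 * (1 - Theta1) + C2star * (1 - Theta2)
  /\
  C 3 = - (qpoch_inf (- q ^+ 3) (q ^+ 3) * theta (- t ^+ 2) 2 6)
        + C 2 * Theta1 + C2star * Theta2.
Proof.
split; last exact: C3_identity.
have := C3_identity; rewrite -/capparelli_product => E.
(* By the definition of C_2^* the first identity is a rearrangement of the second. *)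
have -> : C 1 = C 2 + C2star - C 3 by rewrite /C2star; ring.
rewrite {1}E /capparelli_product; ring.
Qed.
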